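(* Let $r>1$. Then $\mathcal{G}_{r,0}\cup\mathcal{G}_{0,r}\subset\mathcal{I}_{0,0}$, where $\mathcal{G}_{s,t}$ ($s,t\in\mathbb{R}$) are the Hilbert spaces obtained by completing $\mathcal{S}(\mathbb{R}^2)$ in the norms $\|\cdot\|_{st}$, and $\mathcal{I}_{0,0}:=\{f\times g: f,g\in\mathcal{G}_{0,0}=L^2(\mathbb{R}^2)\}$ is the set of twisted products of two square-integrable functions.
   Context: Notation. $\mathcal{S}_2=\mathcal{S}(\mathbb{R}^2)$ is the Schwartz space of complex-valued functions of $(q,p)$ and $\mathcal{S}'_2$ its dual; $f^*$ is the complex conjugate; $\mathbb{N}=\{0,1,2,\dots\}$. The norm on $L^2(\mathbb{R}^2)$ is taken with respect to the measure $(4\pi)^{-1}dq\,dp$. Twisted product: for $f,g\in\mathcal{S}_2$, $$(f\times g)(u)=\frac{1}{4\pi^2}\int_{\mathbb{R}^2}\int_{\mathbb{R}^2}f(v)g(w)\,e^{i(u'Jv+v'Jw+w'Ju)}\,dv\,dw,\qquad J=\begin{pmatrix}0&1\\-1&0\end{pmatrix},$$ where $u'Jv$ denotes transpose$(u)Jv$. It satisfies $\|f\times g\|\le\|f\|\,\|g\|$, where $\|\cdot\|$ is the norm of $L^2(\mathbb{R}^2,(4\pi)^{-1}dq\,dp)$, and so extends by continuity to a product on $L^2(\mathbb{R}^2)$. Twisted Hermite basis: for $m\ge n$ in $\mathbb{N}$, $$f_{mn}(q,p)=2(-1)^n\sqrt{\tfrac{n!}{m!}}\,(q-ip)^{m-n}L_n^{m-n}(q^2+p^2)\,e^{-(q^2+p^2)/2},$$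 with $L_n^{\alpha}$ the associated Laguerre polynomials, and $f_{mn}:=f_{nm}^*$ for $m<n$. These form an orthonormal basis of $L^2(\mathbb{R}^2,(4\pi)^{-1}dq\,dp)$ and satisfy $f_{mn}\times f_{kl}=\delta_{nk}f_{ml}$. Hilbert spaces: for $s,t\in\mathbb{R}$, $\mathcal{G}_{s,t}$ is the completion of $\mathcal{S}_2$ in the norm $$\Bigl\|\sum_{m,n=0}^\infty c_{mn}f_{mn}\Bigr\|_{st}^2:=\sum_{m,n=0}^\infty(2m+1)^s(2n+1)^t|c_{mn}|^2;$$ it is identified with the space of those series $\sum c_{mn}f_{mn}$ (convergent in $\mathcal{S}'_2$) for which this sum is finite. In particular $\mathcal{G}_{0,0}=L^2(\mathbb{R}^2)$. (Under the Weyl correspondence, $\mathcal{G}_{0,0}$ corresponds to the Hilbert–Schmidt operators and $\mathcal{I}_{0,0}$ to the trace-class operators on $L^2(\mathbb{R})$, with $f_{mn}$ corresponding to the rank-one operator $|h_m\rangle\langle h_n|$, $h_m$ being the normalized Hermite functions.) *)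

(* Defs.v *)
From HB Require Import structures.
From mathcomp Require Import all_boot all_order all_algebra.
From mathcomp Require Import all_classical all_reals all_analysis.
From mathcomp Require Import complex.

Set Implicit Arguments.
Unset Strict Implicit.
Unset Printing Implicit Defensive.

Import Order.TTheory GRing.Theory Num.Theory.
Import numFieldNormedType.Exports.
Import complex.ComplexField.Normc.

Local Open Scope classical_set_scope.
Local Open Scope ring_scope.
Local Open Scope complex_scope.

Local Notation cRe := complex.Re.
Local Notation cIm := complex.Im.

Section Schwartz.
Context (R : realType).

(* The library puts no topology on R[i], so functions valued in R[i] are
   differentiated through their real and imaginary parts. *)
Definition cderive (v : R * R) (f : R * R -> R[i]) : R * R -> R[i] :=
  fun u => 'D_v (fun x => cRe (f x)) u +i* 'D_v (fun x => cIm (f x)) u.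

Definition cdiff (f : R * R -> R[i]) : Prop :=
  (forall u : R * R, differentiable (fun x => cRe (f x)) u) /\
  (forall u : R * R, differentiable (fun x => cIm (f x)) u).

(* The derivative of order a in q = u.1 and of order b in p = u.2. *)
Definition pderiv (a b : nat) (f : R * R -> R[i]) : R * R -> R[i] :=
  iter a (cderive (1, 0)) (iter b (cderive (0, 1)) f).

Definition smooth (f : R * R -> R[i]) : Prop :=
  forall a b : nat, cdiff (pderiv a b f).

Definition weighted_values (j k a b : nat) (f : R * R -> R[i]) : set R :=
  range (fun u : R * R => `|u.1| ^+ j * `|u.2| ^+ k * normc (pderiv a b f u)).

Definition is_schwartz (f : R * R -> R[i]) : Prop :=
  smooth f /\ forall j k a b : nat, has_ubound (weighted_values j k a b f).

Definition seminorm (j k a b : nat) (f : R * R -> R[i]) : R :=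
  sup (weighted_values j k a b f).

Definition schwartz_pred : {pred (R * R -> R[i])} :=
  mem [set f | is_schwartz f].

Record schwartz := Schwartz {
  schwartz_fun :> R * R -> R[i];
  schwartzP : schwartz_fun \in schwartz_pred }.

HB.instance Definition _ := [isSub for schwartz_fun].
HB.instance Definition _ := [Choice of schwartz by <:].

Lemma ReZD (z : R[i]) (f g : R * R -> R[i]) :
  (fun x : R * R => cRe ((z *: f + g) x)) =
  cRe z *: (fun x => cRe (f x)) + (- cIm z) *: (fun x => cIm (f x))
    + (fun x => cRe (g x)).
Proof.
apply/funext => x; rewrite !fctE /=.
by case: z (f x) (g x) => [a b] [c d] [e h]; rewrite /= -mulNr.
Qed.

Lemma ImZD (z : R[i]) (f g : R * R -> R[i]) :
  (fun x : R * R => cIm ((z *: f + g) x)) =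
  cRe z *: (fun x => cIm (f x)) + cIm z *: (fun x => cRe (f x))
    + (fun x => cIm (g x)).
Proof.
apply/funext => x; rewrite !fctE /=.
by case: z (f x) (g x) => [a b] [c d] [e h].
Qed.

Lemma differentiable_lincomb (x y : R) (p q r : R * R -> R) u :
  differentiable p u -> differentiable q u -> differentiable r u ->
  differentiable (x *: p + y *: q + r) u.
Proof.
move=> dp dq dr.
have dpq := differentiableD (differentiableZ x dp) (differentiableZ y dq).
exact: (differentiableD dpq dr).
Qed.

Lemma cdiffZD z f g : cdiff f -> cdiff g -> cdiff (z *: f + g).
Proof.
move=> [f1 f2] [g1 g2]; split => u.
  by rewrite ReZD; apply: differentiable_lincomb (f1 u) (f2 u) (g1 u).
by rewrite ImZD; apply: differentiable_lincomb (f2 u) (f1 u) (g2 u).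
Qed.

Lemma cderiveZD v z f g : cdiff f -> cdiff g ->
  cderive v (z *: f + g) = z *: cderive v f + cderive v g.
Proof.
move=> [f1 f2] [g1 g2]; apply/funext => u; rewrite /cderive ReZD ImZD.
have D (x y : R) (p q r : R * R -> R) :
    differentiable p u -> differentiable q u -> differentiable r u ->
    'D_v (x *: p + y *: q + r) u = x * 'D_v p u + y * 'D_v q u + 'D_v r u.
  move=> p' q' r'; have dp := @diff_derivable _ _ _ p u v p'.
  have dq := @diff_derivable _ _ _ q u v q'.
  have dr := @diff_derivable _ _ _ r u v r'.
  have dxp := derivableZ (k := x) dp; have dyq := derivableZ (k := y) dq.
  by rewrite (deriveD (derivableD dxp dyq) dr) (deriveD dxp dyq) !deriveZ.
rewrite !D //.
rewrite !fctE; case: z => a b /=; apply/eqP.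
by rewrite eq_complex /= mulNr !eqxx.
Qed.

Lemma pderivZD z f g a b : smooth f -> smooth g ->
  pderiv a b (z *: f + g) = z *: pderiv a b f + pderiv a b g.
Proof.
move=> sf sg; rewrite /pderiv; elim: a => [|a IHa] /=; last first.
  by rewrite IHa cderiveZD //; [exact: (sf a b)|exact: (sg a b)].
elim: b => [//|b IHb] /=.
by rewrite IHb cderiveZD //; [exact: (sf 0 b)|exact: (sg 0 b)].
Qed.

Lemma normc_triangle (x y : R[i]) : normc (x + y) <= normc x + normc y.
Proof. exact: (@ler_normD R (Rcomplex R)). Qed.

Lemma pderiv_cst0 a b : pderiv a b 0 = 0.
Proof.
have D0 v : cderive v 0 = 0.
  apply/funext => u; rewrite /cderive.
  by rewrite -[fun=> _]/(cst (0 : R)) derive_cst.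
rewrite /pderiv; elim: a => [|a IHa] /=; last by rewrite IHa D0.
by elim: b => [//|b IHb] /=; rewrite IHb D0.
Qed.

Lemma schwartz_submod_closed : submod_closed schwartz_pred.
Proof.
split=> [|z f g].
  rewrite inE; split=> [a b|j k a b].
    by rewrite pderiv_cst0; split=> u; exact: differentiable_cst.
  exists 0 => _ [u _ <-]; rewrite pderiv_cst0.
  by rewrite /normc /= expr0n addr0 sqrtr0 mulr0.
rewrite !inE => -[sf bf] [sg bg]; split=> [a b|j k a b].
  by rewrite pderivZD //; apply: cdiffZD.
have [M hM] := bf j k a b; have [N hN] := bg j k a b.
exists (normc z * M + N) => _ [u _ <-]; rewrite pderivZD //.
set w := `|u.1| ^+ j * `|u.2| ^+ k; have w0 : 0 <= w by rewrite mulr_ge0 ?exprn_ge0.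
have z0 : 0 <= normc z by case: z => x y; exact: sqrtr_ge0.
apply: (@le_trans _ _ (normc z * (w * normc (pderiv a b f u))
   + w * normc (pderiv a b g u))).
  by rewrite mulrCA -mulrDr -normcM ler_wpM2l //; apply: normc_triangle.
by apply: lerD; [apply: ler_wpM2l => //|]; [apply: hM|apply: hN]; exists u.
Qed.

HB.instance Definition _ := GRing.isSubmodClosed.Build _ _ schwartz_pred
  schwartz_submod_closed.

HB.instance Definition _ := [SubChoice_isSubLmodule of schwartz by <:].

(* Continuity of a linear functional for the Schwartz topology: domination by
   finitely many seminorms. *)
Definition is_tempered (T : schwartz -> R[i]) : Prop :=
  exists (C : R) (N : nat), forall phi : schwartz,
    normc (T phi) <= C * \sum_(j < N) \sum_(k < N) \sum_(a < N) \sum_(b < N)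
                           seminorm j k a b phi.

Record tempered := Tempered {
  tempered_fun :> {scalar schwartz};
  temperedP : is_tempered tempered_fun }.

End Schwartz.

Section PhaseSpace.
Context (R : realType).
Implicit Types (f g h : R * R -> R[i]) (u v w : R * R).

(* R * R with its Borel sigma-algebra. *)
Definition plane : measurableType _ := (measurableTypeR R * measurableTypeR R)%type.

Definition leb2 : {measure set plane -> \bar R} :=
  (@lebesgue_measure R \x @lebesgue_measure R)%E.

Lemma inv4pi_ge0 : 0 <= (4 * pi)^-1 :> R.
Proof. by rewrite invr_ge0 mulr_ge0// pi_ge0. Qed.

Definition phase_measure : {measure set plane -> \bar R} :=
  mscale (NngNum inv4pi_ge0) leb2.

Definition cint f : R[i] :=
  (\int[leb2]_u cRe (f u)) +i* (\int[leb2]_u cIm (f u)).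

Definition expi (x : R) : R[i] := cos x +i* sin x.

Definition L2norm f : \bar R :=
  ('N[phase_measure]_2%:E[EFin \o (@normc R \o f)])%E.

(* Elements of L^2 are represented by Borel functions: L2cvg and pairing below
   depend on such a function only up to a null set. *)
Definition L2 f : Prop :=
  [/\ measurable_fun setT (fun u : plane => cRe (f u)),
      measurable_fun setT (fun u : plane => cIm (f u)) &
      (L2norm f < +oo)%E].

(* sympl u v is u'Jv for J = ((0, 1), (-1, 0)). *)
Definition sympl u v : R := u.1 * v.2 - u.2 * v.1.

Definition twisted f g : R * R -> R[i] := fun u =>
  ((4 * pi ^+ 2)^-1)%:C *
  cint (fun w => cint (fun v =>
    f v * g w * expi (sympl u v + sympl v w + sympl w u))).

Definition L2cvg (F : nat -> R * R -> R[i]) f : Prop :=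
  (fun k => L2norm (fun u => F k u - f u)) @ \oo --> 0%E.

(* The extension by continuity of the product to L^2: h represents f x g when it
   is the L^2 limit of products of Schwartz functions approximating f and g.
   Because ||F x G|| <= ||F|| ||G||, the limit does not depend on the choice of
   the approximations. *)
Definition is_twisted_prod f g h : Prop :=
  exists F G : nat -> schwartz R,
    [/\ L2cvg F f, L2cvg G g & L2cvg (fun k => twisted (F k) (G k)) h].

(* The associated Laguerre polynomial L_n^a, for a in nat, evaluated at x. *)
Definition laguerre (n a : nat) (x : R) : R :=
  \sum_(j < n.+1) (-1) ^+ j * 'C(n + a, n - j)%:R * x ^+ j / (j`!)%:R.

(* f_mn for n <= m. *)
Definition hermite_lower (m n : nat) u : R[i] :=
  let r2 := u.1 ^+ 2 + u.2 ^+ 2 in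
  (2 * (-1) ^+ n * Num.sqrt ((n`!)%:R / (m`!)%:R))%:C *
  (u.1 -i* u.2) ^+ (m - n) *
  (laguerre n (m - n) r2 * expR (- (r2 / 2)))%:C.

Definition twisted_hermite (m n : nat) u : R[i] :=
  if (n <= m)%N then hermite_lower m n u else (hermite_lower n m u)^*.

(* The embedding of functions into S': pairing f is phi |-> \int f phi. *)
Definition pairing f (phi : schwartz R) : R[i] := cint (fun u => f u * phi u).

Definition weighted_norm2 (s t : R) (c : nat -> nat -> R[i]) : \bar R :=
  (\sum_(m <oo) \sum_(n <oo)
     ((2 * m + 1)%:R `^ s * (2 * n + 1)%:R `^ t * normc (c m n) ^+ 2)%:E)%E.

(* T is the sum of c m n * f_mn in S', by square partial sums; when
   weighted_norm2 s t c is finite the order of summation is irrelevant. *)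
Definition hermite_series (c : nat -> nat -> R[i]) (T : tempered R) : Prop :=
  forall phi : schwartz R,
    (fun N : nat => normc (\sum_(m < N) \sum_(n < N)
         c m n * pairing (twisted_hermite m n) phi - T phi)) @ \oo --> (0 : R).

(* The completion of S for the norm (s, t), as a subspace of S': the sums of the
   series c m n * f_mn of finite norm. *)
Definition Gspace (s t : R) : set (tempered R) :=
  [set T | exists c : nat -> nat -> R[i],
     (weighted_norm2 s t c < +oo)%E /\ hermite_series c T].

Definition I00 : set (tempered R) :=
  [set T | exists f g h : R * R -> R[i],
     [/\ L2 f, L2 g, L2 h, is_twisted_prod f g h &
         forall phi : schwartz R, T phi = pairing h phi]].

End PhaseSpace.

Arguments I00 : clear implicits.

(* Main.v *)
(** Put z = q - ip. Then f_mn = 2 (m! n!)^(-1/2) H_mn(z, z^* ) e^(-|z|^2/2), where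
    the complex Hermite polynomials H_mn satisfy H_(m+1)n = z H_mn - d H_mn / d z^*.
    Integrating by parts against Gaussian weights therefore evaluates both
    integrals of the twisted product, giving f_mn x f_kl = delta_nk f_ml, and the
    value of the outer integral at the origin is the orthogonality relation.
    If sum (2m+1)^r |c_mn|^2 is finite, then sum c_mn f_mn is the product of
    sum (2m+1)^(-r/2) f_mm, which is square integrable because r > 1, and of
    sum (2m+1)^(r/2) c_mn f_mn. For square partial sums, which are Schwartz
    functions, this factorization is an exact identity, and the three sequences of
    partial sums converge in L^2 by Riesz-Fischer. The weight in n is handled by
    putting the diagonal factor on the right. *)

From HB Require Import structures.
Require Import Defs.
From mathcomp Require Import all_boot all_order all_algebra.
From mathcomp Require Import all_classical all_reals all_analysis.
From mathcomp Require Import measurable_realfun complex ring lra zify.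

Import Order.TTheory GRing.Theory Num.Theory.
Import numFieldNormedType.Exports.
Import complex.ComplexField.Normc.
Local Open Scope classical_set_scope.
Local Open Scope ring_scope.
Local Open Scope complex_scope.

Set Implicit Arguments.
Unset Strict Implicit.
Unset Printing Implicit Defensive.

Local Notation cRe := complex.Re.
Local Notation cIm := complex.Im.

(** * Complex-valued integrals *)

Section ComplexIntegral.
Context {R : realType} d {T : measurableType d} (mu : {measure set T -> \bar R}).
Implicit Types f g : T -> R[i].

(** Grouping the phase as [sympl w u + sympl v (w - u)] turns the inner integral into a symplectic
    Fourier transform at [w - u], of which f_mn is an eigenfunction with eigenvalue 2 pi (-1)^m. The
    outer integral then pairs f_mn(w - u) with f_kl(w), and its phase completes the two Gaussians to
    a weight whose linear exponent is holomorphic in q - ip. So both integrals carry a Gaussian with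
    a complex linear coefficient, and their analysis reduces to its moments on the line; the closed
    form comes from differentiating in the imaginary part of that coefficient rather than from a
    contour shift. The rest is algebra: integration is a linear functional on bivariate polynomials
    obeying integration by parts, and derivations lower the indices of the complex Hermite
    polynomials. Since the product on L2 is defined by a limit, a factorization of the coefficient
    matrix has to survive truncation. With a diagonal factor the product of the truncations is the
    truncation of the product, so no tail has to be estimated. *)

Definition cmeas f := measurable_fun setT (fun x => cRe (f x)) /\
  measurable_fun setT (fun x => cIm (f x)).

Definition cintegrable f := mu.-integrable setT (EFin \o (fun x => cRe (f x))) /\
  mu.-integrable setT (EFin \o (fun x => cIm (f x))).

(** The shape of [cint] over an arbitrary measure, so that moments on the line and integrals on the
    plane share the lemmas on linearity; on the plane it is convertible to [cint]. *)
Definition cintegral f : R[i] :=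
  (\int[mu]_x cRe (f x)) +i* (\int[mu]_x cIm (f x)).

Lemma cReD (x y : R[i]) : cRe (x + y) = cRe x + cRe y. Proof. by case: x y => ? ? []. Qed.
Lemma cImD (x y : R[i]) : cIm (x + y) = cIm x + cIm y. Proof. by case: x y => ? ? []. Qed.
Lemma cReM (x y : R[i]) : cRe (x * y) = cRe x * cRe y - cIm x * cIm y.
Proof. by case: x y => ? ? []. Qed.
Lemma cImM (x y : R[i]) : cIm (x * y) = cRe x * cIm y + cIm x * cRe y.
Proof. by case: x y => ? ? []. Qed.

Lemma integrableRZ (k : R) (f : T -> R) : mu.-integrable setT (EFin \o f) ->
  mu.-integrable setT (EFin \o (fun x => k * f x)).
Proof.
by move=> h; apply: (eq_integrable _ _ _ _ (integrableZl _ k h)).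
Qed.

Lemma integrableRD (f g : T -> R) : mu.-integrable setT (EFin \o f) ->
  mu.-integrable setT (EFin \o g) -> mu.-integrable setT (EFin \o (fun x => f x + g x)).
Proof.
by move=> h k; apply: (eq_integrable _ _ _ _ (integrableD _ h k)).
Qed.

Lemma cintegrableZ k f : cintegrable f -> cintegrable (fun x => k * f x).
Proof.
move=> [hr hi]; split.
  under eq_fun do rewrite cReM -mulNr.
  by apply: integrableRD; apply: integrableRZ.
under eq_fun do rewrite cImM.
by apply: integrableRD; apply: integrableRZ.
Qed.

Lemma cintegrableD f g : cintegrable f -> cintegrable g ->
  cintegrable (fun x => f x + g x).
Proof.
move=> [fr fi] [gr gi]; split.
  by under eq_fun do rewrite cReD; apply: integrableRD.
by under eq_fun do rewrite cImD; apply: integrableRD.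
Qed.

Lemma cintegralZ k f : cintegrable f -> cintegral (fun x => k * f x) = k * cintegral f.
Proof.
move=> [hr hi]; apply/eqP; rewrite eq_complex /=; apply/andP; split; apply/eqP.
  rewrite cReM /=; under eq_Rintegral do rewrite cReM -mulNr.
  by rewrite RintegralD ?RintegralZl ?mulNr //; apply: integrableRZ.
rewrite cImM /=; under eq_Rintegral do rewrite cImM.
by rewrite RintegralD ?RintegralZl //; apply: integrableRZ.
Qed.

Lemma cintegralD f g : cintegrable f -> cintegrable g ->
  cintegral (fun x => f x + g x) = cintegral f + cintegral g.
Proof.
move=> [fr fi] [gr gi]; apply/eqP; rewrite eq_complex /=; apply/andP; split; apply/eqP.
  by rewrite /=; under eq_Rintegral do rewrite cReD; rewrite RintegralD.
by rewrite /=; under eq_Rintegral do rewrite cImD; rewrite RintegralD.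
Qed.

Lemma cintegrable0 : cintegrable (fun=> 0).
Proof. by split; exact: integrable0. Qed.

Lemma cintegral0 : cintegral (fun=> 0) = 0.
Proof. by rewrite /cintegral /= /Rintegral integral0. Qed.

Lemma cintegrable_sum I (s : seq I) (F : I -> T -> R[i]) :
  (forall i, cintegrable (F i)) -> cintegrable (fun x => \sum_(i <- s) F i x).
Proof.
move=> h; elim: s => [|i s IH].
  by under eq_fun do rewrite big_nil; exact: cintegrable0.
by under eq_fun do rewrite big_cons; apply: cintegrableD.
Qed.

Lemma cintegral_sum I (s : seq I) (F : I -> T -> R[i]) :
  (forall i, cintegrable (F i)) ->
  cintegral (fun x => \sum_(i <- s) F i x) = \sum_(i <- s) cintegral (F i).
Proof.
move=> h; elim: s => [|i s IH].
  by under eq_fun do rewrite big_nil; rewrite big_nil cintegral0.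
rewrite big_cons -IH -cintegralD //; last exact: cintegrable_sum.
by under eq_fun do rewrite big_cons.
Qed.

Lemma eq_cintegral f g : f =1 g -> cintegral f = cintegral g.
Proof. by move=> /funext ->. Qed.

Lemma eq_cintegrable f g : f =1 g -> cintegrable f -> cintegrable g.
Proof. by move=> /funext ->. Qed.

Lemma ler_Re_normc (z : R[i]) : `|cRe z| <= normc z.
Proof.
by case: z => a b /=; rewrite -sqrtr_sqr ler_wsqrtr // lerDl sqr_ge0.
Qed.

Lemma ler_Im_normc (z : R[i]) : `|cIm z| <= normc z.
Proof.
by case: z => a b /=; rewrite -sqrtr_sqr ler_wsqrtr // lerDr sqr_ge0.
Qed.

Lemma cmeas_integrable f (g : T -> R) : cmeas f -> mu.-integrable setT (EFin \o g) ->
  (forall x, normc (f x) <= g x) -> cintegrable f.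
Proof.
move=> [mr mi] ig fg; split; apply: (le_integrable _ _ _ ig) => //=.
- exact/measurable_EFinP.
- by move=> x _; rewrite lee_fin (le_trans (ler_Re_normc _)) // (le_trans (fg x)) // ler_norm.
- exact/measurable_EFinP.
- by move=> x _; rewrite lee_fin (le_trans (ler_Im_normc _)) // (le_trans (fg x)) // ler_norm.
Qed.

Lemma cmeasM f g : cmeas f -> cmeas g -> cmeas (fun x => f x * g x).
Proof.
move=> [fr fi] [gr gi]; split.
  under eq_fun do rewrite cReM.
  by apply: measurable_funB; apply: measurable_funM.
under eq_fun do rewrite cImM.
by apply: measurable_funD; apply: measurable_funM.
Qed.

Lemma cmeasD f g : cmeas f -> cmeas g -> cmeas (fun x => f x + g x).
Proof.
move=> [fr fi] [gr gi]; split.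
  by under eq_fun do rewrite cReD; apply: measurable_funD.
by under eq_fun do rewrite cImD; apply: measurable_funD.
Qed.

Lemma cmeas_cst (c : R[i]) : cmeas (fun=> c).
Proof. by split; exact: measurable_cst. Qed.

Lemma cmeasR (f : T -> R) : measurable_fun setT f -> cmeas (fun x => (f x)%:C).
Proof. by move=> mf; split => //=; exact: measurable_cst. Qed.

Lemma cmeas_normc f : cmeas f -> measurable_fun setT (fun x => normc (f x)).
Proof.
move=> [mr mi].
rewrite (_ : (fun x => _) = (fun x => Num.sqrt (cRe (f x) ^+ 2 + cIm (f x) ^+ 2))); last first.
  by apply/funext => x; case: (f x).
have ms : measurable_fun setT (@Num.sqrt R).
  by apply: continuous_measurable_fun; exact: sqrt_continuous.
have mn : measurable_fun setT (fun x => cRe (f x) ^+ 2 + cIm (f x) ^+ 2).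
  by apply: measurable_funD; apply: measurable_funX.
exact: (measurableT_comp ms mn).
Qed.

End ComplexIntegral.

(** * Separation of variables in integrals over a product space *)

Section ProductIntegral.
Context {R : realType} d1 d2 {T1 : measurableType d1} {T2 : measurableType d2}.
Context (m1 : {sigma_finite_measure set T1 -> \bar R})
        (m2 : {sigma_finite_measure set T2 -> \bar R}).

(** By Tonelli only the iterated integral of the modulus has to be finite, and there the inner
    integral is a constant factor. *)
Lemma integrable_prodM (f : T1 -> R) (g : T2 -> R) :
  m1.-integrable setT (EFin \o f) -> m2.-integrable setT (EFin \o g) ->
  (m1 \x m2)%E.-integrable setT (EFin \o (fun u => f u.1 * g u.2)).
Proof.
move=> fi gi; apply/integrable12ltyP.
  apply/measurable_EFinP; apply: measurable_funM.
    apply: measurableT_comp => //.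
    by move/integrableP : fi => [/measurable_EFinP].
  apply: measurableT_comp => //.
  by move/integrableP : gi => [/measurable_EFinP].
have [mf If] := integrableP _ _ _ fi; have [mg Ig] := integrableP _ _ _ gi.
rewrite (_ : (fun x => _) = (fun x => `|(EFin \o f) x| * (\int[m2]_y `|(EFin \o g) y|)))%E; last first.
  apply/funext => x /=.
  under eq_integral do rewrite /= normrM EFinM.
  rewrite ge0_integralZl_EFin //=.
  by apply/measurable_EFinP; apply: measurableT_comp => //; exact/measurable_EFinP.
rewrite ge0_integralZr //.
- apply: lte_mul_pinfty => //; first exact: integral_ge0.
  rewrite ge0_fin_numE //; exact: integral_ge0.
- exact: measurableT_comp.
- exact: integral_ge0.
Qed.

Lemma Rintegral_prodM (f : T1 -> R) (g : T2 -> R) :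
  m1.-integrable setT (EFin \o f) -> m2.-integrable setT (EFin \o g) ->
  \int[(m1 \x m2)%E]_u (f u.1 * g u.2) = (\int[m1]_x f x) * (\int[m2]_y g y).
Proof.
move=> fi gi; rewrite /Rintegral -fineM ?integrable_fin_num//; congr fine.
rewrite -integral12_prod_meas1; last exact: integrable_prodM.
have Gf := integrable_fin_num measurableT gi.
rewrite -(fineK Gf) -integralZr //; apply: eq_integral => x _.
by rewrite /fubini_F /= (fineK Gf) -integralZl.
Qed.

Lemma cintegrable_prodM (f : T1 -> R[i]) (g : T2 -> R[i]) :
  cintegrable m1 f -> cintegrable m2 g ->
  cintegrable (m1 \x m2)%E (fun u => f u.1 * g u.2).
Proof.
move=> [fr fi] [gr gi]; split.
  under eq_fun do rewrite cReM -mulN1r.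
  apply: integrableRD; first exact: (integrable_prodM fr gr).
  by apply: integrableRZ; exact: (integrable_prodM fi gi).
under eq_fun do rewrite cImM.
apply: integrableRD; first exact: (integrable_prodM fr gi).
exact: (integrable_prodM fi gr).
Qed.

Lemma cintegral_prodM (f : T1 -> R[i]) (g : T2 -> R[i]) :
  cintegrable m1 f -> cintegrable m2 g ->
  cintegral (m1 \x m2)%E (fun u => f u.1 * g u.2) = cintegral m1 f * cintegral m2 g.
Proof.
move=> [fr fi] [gr gi]; apply/eqP; rewrite eq_complex /=.
apply/andP; split; apply/eqP.
  under [LHS]eq_Rintegral do rewrite cReM.
  rewrite RintegralB //; [|exact: (integrable_prodM fr gr)|exact: (integrable_prodM fi gi)].
  by rewrite (Rintegral_prodM fr gr) (Rintegral_prodM fi gi).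
under [LHS]eq_Rintegral do rewrite cImM.
rewrite RintegralD //; [|exact: (integrable_prodM fr gi)|exact: (integrable_prodM fi gr)].
by rewrite (Rintegral_prodM fr gi) (Rintegral_prodM fi gr).
Qed.

End ProductIntegral.

(** * Gaussian moments *)

Section RealLine.
Context {R : realType}.
Local Notation leb := (@lebesgue_measure R).

(** Fundamental theorem of calculus on the whole line: the integrals over [[-n, n]] equal
    [F n - F (- n)] and tend to the full integral by dominated convergence. *)
Lemma integral_derive_eq0 (F f : R -> R) :
  (forall x : R, is_derive x 1 F (f x)) -> continuous f ->
  leb.-integrable setT (EFin \o f) ->
  F n%:R @[n --> \oo] --> 0 -> F (- n%:R) @[n --> \oo] --> 0 ->
  \int[leb]_x f x = 0.
Proof.
move=> dF cf fi Fp Fm.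
have mI n : measurable (`[- n%:R, n%:R]%classic : set R) by exact: measurable_itv.
pose g n := (EFin \o f) \_ (`[- n%:R, n%:R]%classic : set R).
have mf := measurable_int _ fi.
have mg n : measurable_fun setT (g n).
  by apply/(measurable_restrictT _ (mI n)); exact: measurable_funS mf.
have cg : {ae leb, forall x, setT x -> g ^~ x @ \oo --> (EFin \o f) x}.
  apply: aeW => x _; apply: cvg_near_cst.
  near=> n; rewrite /g patchE mem_set //= in_itv /= -ler_norml.
  by near: n; exact: nbhs_infty_ger.
have dg : {ae leb, forall x n, setT x -> (`|g n x| <= `|(EFin \o f) x|)%E}.
  apply: aeW => x n _; rewrite /g patchE; case: ifP => // _.
  by rewrite abse0.
have [_ _] := @dominated_convergence _ _ _ leb _ measurableT g _ _ mg mf cg (integrable_abse fi) dg.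
have Ig : (fun n => \int[leb]_x g n x)%E = (fun n => (F n%:R - F (- n%:R))%:E).
  apply/funext => n; rewrite /g -integral_mkcond.
  (* The theorem on compact intervals asks for distinct endpoints, so the degenerate interval at
     [n = 0] is treated apart. *)
  have [->|n0] := eqVneq n 0%N.
    by rewrite oppr0 subrr set_itv1 integral_set1.
  rewrite (@continuous_FTC2 _ f F) //.
  - by rewrite gtrN // ltr0n lt0n.
  - exact: continuous_subspaceT.
  - split.
    + by move=> x _; apply: ex_derive.
    + apply: cvg_at_right_filter; apply: differentiable_continuous.
      by apply/derivable1_diffP; exact: ex_derive.
    + apply: cvg_at_left_filter; apply: differentiable_continuous.
      by apply/derivable1_diffP; exact: ex_derive.
  - by move=> x _; rewrite derive1E; exact: derive_val.
rewrite Ig => h1.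
have h2 : (F n%:R - F (- n%:R))%:E @[n --> \oo] --> (0 - 0 : R)%:E.
  by apply: cvg_EFin; [exact: nearW|exact: cvgB].
have := cvg_unique _ h1 h2.
by rewrite subrr /Rintegral => ->.
Unshelve. all: by end_near. Qed.

Lemma gauss_shift (lam m : R) : 0 < lam ->
  leb.-integrable setT (EFin \o (fun x => expR (- (lam * (x - m) ^+ 2)))) /\
  \int[leb]_x expR (- (lam * (x - m) ^+ 2)) = Num.sqrt (pi / lam).
Proof.
(* The standard deviation with [1 / (2 s^2) = lam], for which the integrand is a multiple of the
   normal density of mean [m]. *)
move=> l0; pose s := Num.sqrt (2 * lam)^-1.
have s2 : s ^+ 2 = (2 * lam)^-1 by rewrite sqr_sqrtr // invr_ge0 mulr_ge0 // ltW.
have s0 : s != 0.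
  by rewrite gt_eqF // sqrtr_gt0 invr_gt0 mulr_gt0.
have l0' : lam != 0 by rewrite gt_eqF.
have E x : expR (- (lam * (x - m) ^+ 2)) = Num.sqrt (pi / lam) * normal_pdf m s x.
  rewrite normal_pdfE //= /normal_peak [RHS]mulrA s2.
  have -> : (2 * lam)^-1 * pi *+ 2 = pi / lam by field.
  rewrite divff ?mul1r; last by rewrite gt_eqF // sqrtr_gt0 divr_gt0 // pi_gt0.
  by rewrite /normal_fun s2; congr expR; field.
split.
  under eq_fun do rewrite E.
  by apply: integrableRZ; exact: integrable_normal_pdf.
under eq_Rintegral do rewrite E.
rewrite RintegralZl //; last exact: integrable_normal_pdf.
by rewrite /Rintegral integral_normal_pdf /= mulr1.
Qed.

(** Half of the quadratic decay is spent: one term [lam / 4 * x ^+ 2] absorbs the power of [x],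
    another absorbs the linear term by completing a square. *)
Lemma pow_gauss_bound (lam a : R) n : 0 < lam ->
  exists2 K : R, 0 < K & forall x, `|x| ^+ n * expR (- lam * x ^+ 2 + a * x)
    <= K * expR (- (lam / 2 * x ^+ 2)).
Proof.
(* Comes from the term of degree [n.+1] in the series of [expR (lam / 4 * x ^+ 2)], which bounds
   [x ^+ 2 ^+ n.+1]. That power dominates [|x| ^+ n] for [|x| > 1]; the 1 in [1 + k] covers
   [|x| <= 1]. *)
move=> l0; pose k := ((lam / 4) ^+ n.+1)^-1 * (n.+1)`!%:R.
have k0 : 0 < k by rewrite mulr_gt0 ?ltr0n ?fact_gt0 // invr_gt0 exprn_gt0 // divr_gt0.
exists ((1 + k) * expR (a ^+ 2 / lam)); first by rewrite mulr_gt0 ?expR_gt0 // addr_gt0.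
move=> x.
have B1 : `|x| ^+ n <= (1 + k) * expR (lam / 4 * x ^+ 2).
  have t0 : 0 <= lam / 4 * x ^+ 2 by rewrite mulr_ge0 ?sqr_ge0 // divr_ge0 // ltW.
  have e1 : 1 <= expR (lam / 4 * x ^+ 2) by apply: le_trans (expR_ge1Dx _); rewrite lerDl.
  have := expR_ge1Dxn n t0.
  set e := expR _ in e1 *; rewrite exprMn => h.
  have h2 : x ^+ 2 ^+ n.+1 <= k * e.
    have : (lam / 4) ^+ n.+1 * x ^+ 2 ^+ n.+1 / (n.+1)`!%:R <= e.
      by apply: le_trans h; rewrite lerDr.
    rewrite ler_pdivrMr ?ltr0n ?fact_gt0 // => h2.
    rewrite /k -mulrA ler_pdivlMl ?exprn_gt0 ?divr_gt0 //.
    by rewrite [_%:R * e]mulrC.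
  rewrite mulrDl mul1r; have [x1|x1] := leP `|x| 1.
    apply: (@le_trans _ _ 1); first exact: exprn_ile1.
    apply: (le_trans e1).
    by rewrite lerDl mulr_ge0 // ?(ltW k0) // (le_trans _ e1).
  apply: (@le_trans _ _ (x ^+ 2 ^+ n.+1)).
    rewrite -(real_normK (num_real x)) -exprM ler_eXn2l // ?ltW //.
    by rewrite mul2n -addnn addSnnS leq_addr.
  by apply: (le_trans h2); rewrite lerDr (le_trans _ e1).
apply: (@le_trans _ _ ((1 + k) * expR (lam / 4 * x ^+ 2) *
    expR (- lam * x ^+ 2 + a * x))).
  by rewrite ler_wpM2r // expR_ge0.
rewrite -[leLHS]mulrA -[leRHS]mulrA -!expRD ler_pM2l ?addr_gt0 // ler_expR -subr_ge0.
have -> : a ^+ 2 / lam + - (lam / 2 * x ^+ 2) -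
   (lam / 4 * x ^+ 2 + (- lam * x ^+ 2 + a * x)) = (lam * x / 2 - a) ^+ 2 / lam.
  by field; rewrite gt_eqF.
by rewrite divr_ge0 ?sqr_ge0 // ltW.
Qed.

End RealLine.

Section ComplexExp.
Context {R : realType}.
Implicit Types z w : R[i].

Definition cexp z : R[i] := (expR (cRe z))%:C * expi (cIm z).

Lemma expiD (x y : R) : expi (x + y) = expi x * expi y.
Proof.
rewrite /expi cosD sinD; apply/eqP; rewrite eq_complex /=.
by apply/andP; split; apply/eqP; ring.
Qed.

Lemma cexpD z w : cexp (z + w) = cexp z * cexp w.
Proof. by rewrite /cexp cReD cImD expRD expiD rmorphM /= mulrACA. Qed.

Lemma cexp0 : cexp 0 = 1.
Proof. by rewrite /cexp /= expR0 /expi cos0 sin0 mul1r. Qed.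

Lemma cexpR (x : R) : cexp x%:C = (expR x)%:C.
Proof. by rewrite /cexp /= /expi cos0 sin0 mulr1. Qed.

Lemma cexp_expi (x : R) : expi x = cexp (0 +i* x).
Proof. by rewrite /cexp /= expR0 mul1r. Qed.

Lemma normc_expi (x : R) : normc (expi x) = 1.
Proof. by rewrite /= cos2Dsin2 sqrtr1. Qed.

Lemma normc_real (x : R) : normc x%:C = `|x|.
Proof. by rewrite /= expr0n addr0 sqrtr_sqr. Qed.

Lemma normc_cexp z : normc (cexp z) = expR (cRe z).
Proof. by rewrite normcM normc_expi mulr1 normc_real ger0_norm ?expR_ge0. Qed.

End ComplexExp.

(** * Moments of a Gaussian with complex linear exponent *)

Section GaussianMoments.
Context {R : realType}.
Local Notation leb := (@lebesgue_measure R).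
Variables (lam : R) (lam0 : 0 < lam).

(** The weight exp(-lam x^2 + c x). The complex [c] carries both the phase of the twisted kernel and
    the cross term of a shifted Gaussian. *)
Definition gw (c : R[i]) (x : R) : R[i] := cexp ((- lam * x ^+ 2)%:C + c * x%:C).

Definition gmoment (c : R[i]) (n : nat) : R[i] :=
  cintegral leb (fun x => (x ^+ n)%:C * gw c x).

Section Real.
Variables a b : R.
Let E x := expR (- lam * x ^+ 2 + a * x).
Let G n x := x ^+ n * E x * cos (b * x).
Let H n x := x ^+ n * E x * sin (b * x).

Lemma gwE x n : (x ^+ n)%:C * gw (a +i* b) x = G n x +i* H n x.
Proof.
rewrite /gw /cexp /= /G /H /E !(mul0r, mulr0, subr0, addr0, add0r).
by apply/eqP; rewrite eq_complex /= !(mul0r, mulr0, subr0, addr0, add0r) !mulrA !eqxx.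
Qed.

Lemma gw_bound n : exists2 K : R, 0 < K & forall x, 
  normc ((x ^+ n)%:C * gw (a +i* b) x) <= K * expR (- (lam / 2 * x ^+ 2)).
Proof.
have [K K0 hK] := pow_gauss_bound a n lam0; exists K => // x.
rewrite normcM normc_cexp normc_real normrX /=.
by rewrite mulr0 subr0; exact: hK.
Qed.

Let dE (x : R) : is_derive x 1 E ((a - 2 * lam * x) * E x).
Proof.
rewrite /E; apply: is_derive_eq.
rewrite /GRing.scale /=.
ring.
Qed.

Let dcos (x : R) : is_derive x 1 (fun x => cos (b * x)) (- b * sin (b * x)).
Proof.
apply: is_derive_eq.
rewrite /GRing.scale /=.
ring.
Qed.

Let dsin (x : R) : is_derive x 1 (fun x => sin (b * x)) (b * cos (b * x)).
Proof.
apply: is_derive_eq.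
rewrite /GRing.scale /=.
ring.
Qed.

(** At [n = 0] the value of [n.-1] is harmless because its coefficient [n%:R] vanishes; the
    recurrences below rely on the same convention. *)
Let dG n (x : R) : is_derive x 1 (G n) (n%:R * G n.-1 x + a * G n x - 2 * lam * G n.+1 x + - b * H n x).
Proof.
have dX : is_derive x 1 (fun x : R => x ^+ n) (n%:R * x ^+ n.-1).
  rewrite (_ : (fun x : R => x ^+ n) = (id : R -> R) ^+ n); last by rewrite exprfctE.
  by apply: (is_derive_eq (is_deriveX n (is_derive_id x 1))); rewrite /GRing.scale /= mulr1.
apply: (is_derive_eq (is_deriveM (is_deriveM dX (dE x)) (dcos x))).
rewrite /GRing.scale !fctE /= /G /H exprS; ring.
Qed.

Let dH n (x : R) : is_derive x 1 (H n) (n%:R * H n.-1 x + a * H n x - 2 * lam * H n.+1 x + b * G n x).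
Proof.
have dX : is_derive x 1 (fun x : R => x ^+ n) (n%:R * x ^+ n.-1).
  rewrite (_ : (fun x : R => x ^+ n) = (id : R -> R) ^+ n); last by rewrite exprfctE.
  by apply: (is_derive_eq (is_deriveX n (is_derive_id x 1))); rewrite /GRing.scale /= mulr1.
apply: (is_derive_eq (is_deriveM (is_deriveM dX (dE x)) (dsin x))).
rewrite /GRing.scale !fctE /= /G /H exprS; ring.
Qed.

Let cG n : continuous (G n).
Proof.
by move=> x; apply: differentiable_continuous; apply/derivable1_diffP; exact: ex_derive.
Qed.

Let cH n : continuous (H n).
Proof.
by move=> x; apply: differentiable_continuous; apply/derivable1_diffP; exact: ex_derive.
Qed.

Lemma cintegrable_moment n : cintegrable leb (fun x => (x ^+ n)%:C * gw (a +i* b) x).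
Proof.
have [K K0 hK] := gw_bound n.
have [ig _] := gauss_shift 0 (divr_gt0 lam0 (ltr0n R 2)).
have ig' : leb.-integrable setT (EFin \o (fun x => K * expR (- (lam / 2 * x ^+ 2)))).
  by apply: integrableRZ; under eq_fun do rewrite -[X in X ^+ 2]subr0.
apply: cmeas_integrable ig' hK; split.
  by under eq_fun do rewrite gwE; exact: (continuous_measurable_fun (@cG n)).
by under eq_fun do rewrite gwE; exact: (continuous_measurable_fun (@cH n)).
Qed.

Let iG n : leb.-integrable setT (EFin \o G n).
Proof. by have [+ _] := cintegrable_moment n; under eq_fun do rewrite gwE. Qed.

Let iH n : leb.-integrable setT (EFin \o H n).
Proof. by have [_] := cintegrable_moment n; under eq_fun do rewrite gwE. Qed.

(** The bit [s] treats both ends of the line at once, and [f] will be the real or the imaginary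
    part. Since [k <= k ^ 2], the Gaussian bound is dominated by a geometric sequence. *)
Lemma moment_cvg0 n (s : bool) (f : R -> R) :
  (forall x, `|f x| <= normc ((x ^+ n)%:C * gw (a +i* b) x)) ->
  f ((-1) ^+ s * k%:R) @[k --> \oo] --> 0.
Proof.
move=> hf; have [K K0 hK] := gw_bound n.
apply/norm_cvg0P.
apply: (@squeeze_cvgr _ _ _ _ (cst 0) (fun k => K * expR (- (lam / 2)) ^+ k)).
- near=> k; rewrite normr_ge0 /=; apply: (le_trans (hf _)); apply: (le_trans (hK _)).
  rewrite ler_pM2l // -expRM_natr ler_expR exprMn sqrr_sign mul1r mulNr lerN2.
  rewrite ler_pM2l ?divr_gt0 // -natrX ler_nat.
  by case: (k) => // m; rewrite expnS expn1 leq_pmulr.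
- exact: cvg_cst.
- rewrite -[X in _ --> X](mulr0 K); apply: cvgMl_tmp; apply: cvg_expr.
  by rewrite ger0_norm ?expR_ge0 // expR_lt1 oppr_lt0 divr_gt0.
Unshelve. all: by end_near. Qed.

Let cZ (k : R) (f : R -> R) : continuous f -> continuous (fun x => k * f x).
Proof. by move=> cf x; apply: cvgMl_tmp; exact: cf. Qed.

Let Rlin (F0 F1 F2 F3 : R -> R) (k0 k1 k2 k3 : R) :
  leb.-integrable setT (EFin \o F0) -> leb.-integrable setT (EFin \o F1) ->
  leb.-integrable setT (EFin \o F2) -> leb.-integrable setT (EFin \o F3) ->
  \int[leb]_x (k0 * F0 x + k1 * F1 x - k2 * F2 x + k3 * F3 x) =
  k0 * (\int[leb]_x F0 x) + k1 * (\int[leb]_x F1 x) - k2 * (\int[leb]_x F2 x)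
    + k3 * (\int[leb]_x F3 x).
Proof.
move=> i0 i1 i2 i3; under eq_Rintegral do rewrite -mulNr.
rewrite !RintegralD ?RintegralZl ?mulNr //; by do ?apply: integrableRD; exact: integrableRZ.
Qed.

Let ibp (F0 F1 F2 F3 : R -> R) : continuous F0 -> continuous F1 -> continuous F2 -> continuous F3 ->
  forall k0 k1 k2 k3 : R, continuous (fun x => k0 * F0 x + k1 * F1 x - k2 * F2 x + k3 * F3 x).
Proof.
move=> c0 c1 c2 c3 k0 k1 k2 k3 x; apply: cvgD; last exact: cZ.
by apply: cvgB; last exact: cZ; apply: cvgD; exact: cZ.
Qed.

Let ibpG n : \int[leb]_x (n%:R * G n.-1 x + a * G n x - 2 * lam * G n.+1 x + - b * H n x) = 0.
Proof.
apply: (@integral_derive_eq0 _ (G n)) => //.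
- exact: ibp.
- under eq_fun do rewrite -!mulNr; do 3?apply: integrableRD; exact: integrableRZ.
- have := @moment_cvg0 n false (G n); under eq_fun do rewrite expr0 mul1r; apply => x.
  by rewrite gwE; exact: (ler_Re_normc (G n x +i* H n x)).
- have := @moment_cvg0 n true (G n); under eq_fun do rewrite expr1 mulN1r; apply => x.
  by rewrite gwE; exact: (ler_Re_normc (G n x +i* H n x)).
Qed.

Let ibpH n : \int[leb]_x (n%:R * H n.-1 x + a * H n x - 2 * lam * H n.+1 x + b * G n x) = 0.
Proof.
apply: (@integral_derive_eq0 _ (H n)) => //.
- exact: ibp.
- under eq_fun do rewrite -!mulNr; do 3?apply: integrableRD; exact: integrableRZ.
- have := @moment_cvg0 n false (H n); under eq_fun do rewrite expr0 mul1r; apply => x.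
  by rewrite gwE; exact: (ler_Im_normc (G n x +i* H n x)).
- have := @moment_cvg0 n true (H n); under eq_fun do rewrite expr1 mulN1r; apply => x.
  by rewrite gwE; exact: (ler_Im_normc (G n x +i* H n x)).
Qed.

Lemma gmoment_ReIm n : gmoment (a +i* b) n = (\int[leb]_x G n x) +i* (\int[leb]_x H n x).
Proof.
by congr (_ +i* _); apply: eq_Rintegral => x _; rewrite gwE.
Qed.

(** The derivative of [x ^+ n * gw c x] has integral zero; [ibpG] and [ibpH] are the real and
    imaginary parts of that fact. *)
Lemma gmoment_ibp_aux n : n%:R * gmoment (a +i* b) n.-1 + (a +i* b) * gmoment (a +i* b) n
  = (2 * lam)%:C * gmoment (a +i* b) n.+1.
Proof.
rewrite !gmoment_ReIm; have := ibpG n; have := ibpH n.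
have <- : (n%:R : R)%:C = n%:R :> R[i] by rewrite rmorph_nat.
rewrite !Rlin // => h1 h2; apply/eqP; rewrite -subr_eq0 eq_complex /=.
by apply/andP; split; apply/eqP; [apply: etrans h2|apply: etrans h1]; ring.
Qed.

End Real.

Lemma gmoment_ibp c n : n%:R * gmoment c n.-1 + c * gmoment c n = (2 * lam)%:C * gmoment c n.+1.
Proof. by case: c => a b; exact: gmoment_ibp_aux. Qed.

Let E a x := expR (- lam * x ^+ 2 + a * x).

Let moment_abs_bound a n : exists2 B : R -> R, leb.-integrable setT (EFin \o B) &
  forall x, `|x ^+ n * E a x| <= B x.
Proof.
have [K K0 hK] := pow_gauss_bound a n lam0.
exists (fun x => K * expR (- (lam / 2 * x ^+ 2))).
  have [ig _] := gauss_shift 0 (divr_gt0 lam0 (ltr0n R 2)).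
  by apply: integrableRZ; move: ig; under eq_fun do rewrite subr0.
by move=> x; rewrite normrM normrX (ger0_norm (expR_ge0 _)); exact: hK.
Qed.

(** Real and imaginary parts of the moments as functions of [b = Im c], the variable in which they
    are differentiated under the integral. *)
Let Cf a b n := \int[leb]_x (x ^+ n * E a x * cos (b * x)).
Let Sf a b n := \int[leb]_x (x ^+ n * E a x * sin (b * x)).

Let intC a b n : leb.-integrable setT (EFin \o (fun x => x ^+ n * E a x * cos (b * x))).
Proof.
have [+ _] := cintegrable_moment a b n.
by under eq_fun do rewrite gwE.
Qed.

Let intS a b n : leb.-integrable setT (EFin \o (fun x => x ^+ n * E a x * sin (b * x))).
Proof.
have [_] := cintegrable_moment a b n.
by under eq_fun do rewrite gwE.
Qed.

Let dcosb (k x b : R) : is_derive b 1 (fun b => k * cos (b * x)) (- (k * x * sin (b * x))).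
Proof. by apply: is_derive_eq; rewrite /GRing.scale /=; ring. Qed.

Let dsinb (k x b : R) : is_derive b 1 (fun b => k * sin (b * x)) (k * x * cos (b * x)).
Proof. by apply: is_derive_eq; rewrite /GRing.scale /=; ring. Qed.

(** Together with [dSf] and with [CS1], which expresses first moments through zeroth ones, this
    gives a linear differential equation in [b] for the zeroth moment. *)
Let dCf a (b : R) : is_derive b 1 (fun b => Cf a b 0) (- Sf a b 1).
Proof.
pose f (b x : R) := x ^+ 0 * E a x * cos (b * x).
have [B iB hB] := moment_abs_bound a 1.
have d1 b' x : partial1of2 f b' x = - (x ^+ 1 * E a x * sin (b' * x)).
  rewrite partial1of2E /f.
  have h := dcosb (x ^+ 0 * E a x) x b'.
  rewrite (@derive_val _ _ _ _ _ _ _ h); ring.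
(* The dominating function does not depend on the frequency, so any open interval around [b] would
   do. *)
have Ib : b \in `]b - 1, b + 1[ by rewrite in_itv /= ltrBlDr ltrDl ltr01 /=.
have intf x : (`]b - 1, b + 1[%classic : set R) x -> leb.-integrable setT (EFin \o f x).
  by move=> _; exact: intC.
have derf x y : (`]b - 1, b + 1[%classic : set R) x -> setT y -> derivable (f ^~ y) x 1.
  by move=> _ _; apply: ex_derive; exact: dcosb.
have B0 y : 0 <= B y by apply: le_trans (hB y).
have Bd x y : (`]b - 1, b + 1[%classic : set R) x -> setT y -> `|partial1of2 f x y| <= B y.
  move=> _ _; rewrite d1 normrN normrM; apply: le_trans (hB y).
  by rewrite ler_piMr // sin_max.
apply: DeriveDef.
  exact: (derivable_under_integral measurableT Ib intf derf B0 iB Bd).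
rewrite -derive1E (differentiation_under_integral measurableT Ib intf derf B0 iB Bd).
under eq_Rintegral do rewrite d1 -mulN1r.
by rewrite RintegralZl ?mulN1r //; exact: intS.
Qed.

Let dSf a (b : R) : is_derive b 1 (fun b => Sf a b 0) (Cf a b 1).
Proof.
pose f (b x : R) := x ^+ 0 * E a x * sin (b * x).
have [B iB hB] := moment_abs_bound a 1.
have d1 b' x : partial1of2 f b' x = x ^+ 1 * E a x * cos (b' * x).
  rewrite partial1of2E /f.
  have h := dsinb (x ^+ 0 * E a x) x b'.
  rewrite (@derive_val _ _ _ _ _ _ _ h); ring.
have Ib : b \in `]b - 1, b + 1[ by rewrite in_itv /= ltrBlDr ltrDl ltr01 /=.
have intf x : (`]b - 1, b + 1[%classic : set R) x -> leb.-integrable setT (EFin \o f x).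
  by move=> _; exact: intS.
have derf x y : (`]b - 1, b + 1[%classic : set R) x -> setT y -> derivable (f ^~ y) x 1.
  by move=> _ _; apply: ex_derive; exact: dsinb.
have B0 y : 0 <= B y by apply: le_trans (hB y).
have Bd x y : (`]b - 1, b + 1[%classic : set R) x -> setT y -> `|partial1of2 f x y| <= B y.
  move=> _ _; rewrite d1 normrM; apply: le_trans (hB y).
  by rewrite ler_piMr // cos_max.
apply: DeriveDef.
  exact: (derivable_under_integral measurableT Ib intf derf B0 iB Bd).
rewrite -derive1E (differentiation_under_integral measurableT Ib intf derf B0 iB Bd).
by under eq_Rintegral do rewrite d1.
Qed.

Let CS1 a b : 2 * lam * Cf a b 1 = a * Cf a b 0 - b * Sf a b 0 /\
              2 * lam * Sf a b 1 = a * Sf a b 0 + b * Cf a b 0.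
Proof.
have := gmoment_ibp (a +i* b) 0; rewrite !gmoment_ReIm mul0r add0r => /eqP.
by rewrite eq_complex /= !mul0r subr0 addr0 => /andP[/eqP <- /eqP <-].
Qed.

Let CS0 a : Cf a 0 0 = Num.sqrt (pi / lam) * expR (a ^+ 2 / (4 * lam)) /\ Sf a 0 0 = 0.
Proof.
have l0 : lam != 0 by rewrite gt_eqF.
have [ig gE] := gauss_shift (a / (2 * lam)) lam0.
split; rewrite /Cf /Sf; last first.
  under eq_Rintegral do rewrite mul0r sin0 mulr0.
  by rewrite /Rintegral integral0.
rewrite -gE mulrC -RintegralZl //; apply: eq_Rintegral => x _.
rewrite expr0 mul1r mul0r cos0 mulr1 /E -expRD; congr expR; field.
by rewrite l0.
Qed.

(* [e^(-c^2/4lam)] times the zeroth moment has zero derivative in [Im c]. *)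
Let CS_const a b (th := a * b / (2 * lam)) :
  expR (- (a ^+ 2 - b ^+ 2) / (4 * lam)) * (Cf a b 0 * cos th + Sf a b 0 * sin th)
    = Num.sqrt (pi / lam) /\
  expR (- (a ^+ 2 - b ^+ 2) / (4 * lam)) * (Sf a b 0 * cos th - Cf a b 0 * sin th) = 0.
Proof.
rewrite {}/th.
have l0 : lam != 0 by rewrite gt_eqF.
have l2 : 2 * lam != 0 by rewrite mulf_neq0.
pose e b := expR (- (a ^+ 2 - b ^+ 2) / (4 * lam)).
pose co b := cos (a * b / (2 * lam)).
pose si b := sin (a * b / (2 * lam)).
pose C b := Cf a b 0.
pose S b := Sf a b 0.
have de (x : R) : is_derive x 1 e (x / (2 * lam) * e x).
  by apply: is_derive_eq; rewrite /GRing.scale /= /e; field.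
have dco (x : R) : is_derive x 1 co (- (a / (2 * lam)) * si x).
  by apply: is_derive_eq; rewrite /GRing.scale /= /si; field.
have dsi (x : R) : is_derive x 1 si (a / (2 * lam) * co x).
  by apply: is_derive_eq; rewrite /GRing.scale /= /co; field.
have C1 x : Cf a x 1 = (a * C x - x * S x) / (2 * lam).
  by have [<- _] := CS1 a x; rewrite [2 * lam * _]mulrC mulfK.
have S1 x : Sf a x 1 = (a * S x + x * C x) / (2 * lam).
  by have [_ <-] := CS1 a x; rewrite [2 * lam * _]mulrC mulfK.
have dC (x : R) : is_derive x 1 C (- ((a * S x + x * C x) / (2 * lam))).
  by rewrite -S1; exact: dCf.
have dS (x : R) : is_derive x 1 S ((a * C x - x * S x) / (2 * lam)).
  by rewrite -C1; exact: dSf.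
have d1 (x : R) : is_derive x 1 (e * (C * co + S * si)) 0.
  by apply: is_derive_eq; rewrite /GRing.scale /= !fctE; field.
have d2 (x : R) : is_derive x 1 (e * (S * co - C * si)) 0.
  by apply: is_derive_eq; rewrite /GRing.scale /= !fctE; field.
have h1 := is_derive_0_is_cst b 0 d1.
have h2 := is_derive_0_is_cst b 0 d2.
have [C0 S0] := CS0 a.
split.
  transitivity ((e * (C * co + S * si)) b) => //; rewrite h1 !fctE /e /C /S /co /si.
  rewrite C0 S0 mulr0 mul0r cos0 mulr1 mul0r addr0 mulrCA -expRD.
  rewrite (_ : _ + _ = 0) ?expR0 ?mulr1 //; by field.
transitivity ((e * (S * co - C * si)) b) => //; rewrite h2 !fctE /e /C /S /co /si.
by rewrite S0 mulr0 mul0r sin0 mulr0 mul0r subr0 mulr0.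
Qed.

(** [CS_const] says that this moment times the inverse exponential is constant, so only the
    exponential has to be moved to the other side. *)
Lemma gmoment0 c : gmoment c 0 = (Num.sqrt (pi / lam))%:C * cexp (c ^+ 2 * ((4 * lam)^-1)%:C).
Proof.
have l0 : lam != 0 by rewrite gt_eqF.
case: c => a b.
have -> : (a +i* b) ^+ 2 * ((4 * lam)^-1)%:C =
   ((a ^+ 2 - b ^+ 2) / (4 * lam)) +i* (a * b / (2 * lam)).
  by apply/eqP; rewrite eq_complex /=; apply/andP; split; apply/eqP; field.
have [h1 h2] := CS_const a b.
suff : gmoment (a +i* b) 0 * cexp (- (((a ^+ 2 - b ^+ 2) / (4 * lam)) +i* (a * b / (2 * lam)))) =
   (Num.sqrt (pi / lam))%:C.
  by move=> <-; rewrite -[RHS]mulrA -cexpD addNr cexp0 mulr1.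
rewrite gmoment_ReIm /cexp /expi /= cosN sinN; apply/eqP; rewrite eq_complex /=.
rewrite -h1 -[X in _ && (_ == X)]h2 mulNr.
by apply/andP; split; apply/eqP; rewrite /Cf /Sf /E; ring.
Qed.

End GaussianMoments.

(** * Complex Hermite polynomials *)

Section ComplexHermite.
Variable A : comNzRingType.
Implicit Types a b : A.

(** Over any commutative ring, because it is taken both at formal polynomials, where derivations
    act, and at complex numbers; [rmorph_chermite] passes from the former to the latter. *)
Fixpoint chermite (m n : nat) a b : A :=
  if m is m'.+1 then a * chermite m' n a b - n%:R * chermite m' n.-1 a b
  else b ^+ n.

Lemma chermiteSl m n a b :
  chermite m.+1 n a b = a * chermite m n a b - n%:R * chermite m n.-1 a b.
Proof. by []. Qed.

Lemma chermiteSr m n a b :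
  chermite m n.+1 a b = b * chermite m n a b - m%:R * chermite m.-1 n a b.
Proof.
elim: m n => [|m IH] n; first by rewrite /= mul0r subr0 exprS.
rewrite [LHS]chermiteSl IH [in RHS]chermiteSl /=.
case: n => [|n]; first by case: m IH => [|m] IH /=; ring.
case: m IH => [|m] IH; first by rewrite /= !exprS; ring.
(* [X], [Y], [Z], [T] stand for the values at [(m.+1, n.+1)], [(m.+1, n)], [(m, n)], [(m, n.+1)].
   Both recurrences express [X] through [Z], and the multiples of [Z] cancel. *)
have aux X Y Z T : X = a * T - n.+1%:R * Z -> X = b * Y - m.+1%:R * Z ->
    a * (b * X - m.+1%:R * T) - n.+2%:R * X = b * (a * X - n.+1%:R * Y) - m.+2%:R * X.
  move=> /eqP; rewrite -subr_eq0 => /eqP e2 /eqP; rewrite -subr_eq0 => /eqP e1.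
  apply: subr0_eq; transitivity (m.+1%:R * (X - (a * T - n.+1%:R * Z))
    - n.+1%:R * (X - (b * Y - m.+1%:R * Z))); first ring.
  by rewrite e1 e2 !mulr0 subr0.
exact: aux (chermiteSl m n.+1 a b) (IH n).
Qed.

Lemma chermite_sym m n a b : chermite m n a b = chermite n m b a.
Proof.
elim: m n => [|m IH] n.
  by elim: n => [|n IHn] //=; rewrite -IHn mul0r subr0 exprS.
by rewrite chermiteSl chermiteSr !IH.
Qed.

(** Induction on [n] by [chermiteSr]: Pascal's rule in [n] splits the sum into its two terms, the
    second one after absorbing a factor of [k.+1]! into ['C(m, k.+1)] to produce [m]. *)
Lemma chermite_explicit m n a b : chermite m n a b =
  \sum_(k < n.+1) (-1) ^+ k * (k`! * 'C(m, k) * 'C(n, k))%:R * a ^+ (m - k) * b ^+ (n - k).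
Proof.
elim: n m => [|n IH] m.
  rewrite big_ord_recl big_ord0 /= bin0 subn0 !mulr1 addr0 mul1r.
  by elim: m => [|m IHm] //=; rewrite IHm mul0r subr0 exprS.
pose F p q k : A := (-1) ^+ k * (k`! * 'C(p, k) * 'C(q, k))%:R * a ^+ (p - k) * b ^+ (q - k).
have -> : \sum_(k < n.+2) (-1) ^+ k * (k`! * 'C(m, k) * 'C(n.+1, k))%:R *
    a ^+ (m - k) * b ^+ (n.+1 - k) =
  \sum_(k < n.+2) (-1) ^+ k * (k`! * 'C(m, k) * 'C(n, k))%:R * a ^+ (m - k) * b ^+ (n.+1 - k)
  - m%:R * \sum_(k < n.+1) F m.-1 n k.
  rewrite big_ord_recl [in RHS]big_ord_recl /= !bin0 -addrA; congr (_ + _).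
  rewrite mulr_sumr -sumrB; apply: eq_bigr => k _; rewrite /F /bump /= !add1n subSS.
  case: m => [|m]; first by rewrite bin0n /= !(muln0, mul0n, mul0r, mulr0, subr0).
  rewrite /= subSS (binS n k) mulnDr natrD mulrDr !mulrDl; congr (_ + _).
  have -> : (k.+1`! * 'C(m.+1, k.+1) * 'C(n, k) = m.+1 * (k`! * 'C(m, k) * 'C(n, k)))%N.
    rewrite factS; have E := mul_bin_diag m.+1 k.
    transitivity (k`! * (k.+1 * 'C(m.+1, k.+1)) * 'C(n, k))%N.
      by rewrite !mulnA [(k.+1 * _)%N]mulnC.
    by rewrite -E /= mulnCA !mulnA.
  rewrite natrM exprS; ring.
rewrite chermiteSr !IH; congr (_ - _).
rewrite [in RHS]big_ord_recr /= (bin_small (ltnSn n)) muln0 mulr0 !mul0r addr0 mulr_sumr.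
apply: eq_bigr => k _; rewrite subSn -1?ltnS // exprS; ring.
Qed.
End ComplexHermite.

Lemma rmorph_chermite (A B : comNzRingType) (f : {rmorphism A -> B}) m n (a b : A) :
  f (chermite m n a b) = chermite m n (f a) (f b).
Proof.
elim: m n => [|m IH] n /=; first by rewrite rmorphXn.
by rewrite rmorphB !rmorphM rmorph_nat !IH.
Qed.

(** * Linear functionals with integration by parts, on complex Hermite polynomials *)

Section Functional.
Variables (F A : comNzRingType) (k : {rmorphism F -> A}) (L : A -> F) (D Db : A -> A).
Hypothesis LD : forall p q, L (p + q) = L p + L q.
Hypothesis LZ : forall c p, L (k c * p) = c * L p.
Hypothesis DD : forall p q, D (p + q) = D p + D q.
Hypothesis DM : forall p q, D (p * q) = D p * q + p * D q.
Hypothesis Dk : forall c, D (k c) = 0.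
Hypothesis DbD : forall p q, Db (p + q) = Db p + Db q.
Hypothesis DbM : forall p q, Db (p * q) = Db p * q + p * Db q.
Hypothesis Dbk : forall c, Db (k c) = 0.
Variables (w wb : A).
Hypotheses (Dw : D w = 1) (Dwb : D wb = 0) (Dbw : Db w = 0) (Dbwb : Db wb = 1).
Let LN p : L (- p) = - L p.
Proof. by rewrite -mulN1r -(rmorphN1 k) LZ mulN1r. Qed.
Let LB p q : L (p - q) = L p - L q. Proof. by rewrite LD LN. Qed.
Let Ln n p : L (n%:R * p) = n%:R * L p.
Proof. by rewrite -(rmorph_nat k) LZ. Qed.

Section Deriv.
Variable d : A -> A.
Hypothesis dD : forall p q, d (p + q) = d p + d q.
Hypothesis dM : forall p q, d (p * q) = d p * q + p * d q.
Hypothesis dk : forall c, d (k c) = 0.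

Let dkM c p : d (k c * p) = k c * d p.
Proof. by rewrite dM dk mul0r add0r. Qed.

Let dnM n p : d (n%:R * p) = n%:R * d p.
Proof. by rewrite -(rmorph_nat k) dkM. Qed.

Let dB p q : d (p - q) = d p - d q.
Proof. by rewrite dD -[in LHS]mulN1r -(rmorphN1 k) dkM rmorphN1 mulN1r. Qed.

Lemma derivation_chermite_r a b : d a = 0 -> d b = 1 ->
  forall m n, d (chermite m n a b) = n%:R * chermite m n.-1 a b.
Proof.
move=> da db; elim=> [|m IH] n.
  elim: n => [|n IHn] /=; first by rewrite expr0 -(rmorph1 k) dk mul0r.
  rewrite exprS dM db mul1r [d _]IHn /=.
  by case: n {IHn} => [|n] /=; rewrite ?expr0 ?exprS; ring.
rewrite /= dB dM da mul0r add0r dnM !IH; case: n => [|n] /=; ring.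
Qed.

Lemma derivation_chermite_l a b : d a = 1 -> d b = 0 ->
  forall m n, d (chermite m n a b) = m%:R * chermite m.-1 n a b.
Proof.
by move=> da db m n; rewrite chermite_sym (derivation_chermite_r db da) chermite_sym.
Qed.
End Deriv.

(* [L] is integration against a complex Gaussian weight on the plane, and the
   hypotheses on [L] are integrations by parts in [w] and [wb]. *)
Lemma chermite_fourier (y yb : F) :
  (forall p, L ((w + k y) * p) = 2%:R * L (Db p)) ->
  (forall p, L ((wb - k yb) * p) = 2%:R * L (D p)) ->
  forall m n, L (chermite m n w wb) = (-1) ^+ m * chermite m n y yb * L 1.
Proof.
move=> hw hwb.
have Lw p : L (w * p) = 2%:R * L (Db p) - y * L p.
  by rewrite -hw mulrDl LD LZ addrK.
have Lwb p : L (wb * p) = 2%:R * L (D p) + yb * L p.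
  by rewrite -hwb mulrBl LB LZ subrK.
have dr := derivation_chermite_r DbD DbM Dbk Dbw Dbwb.
have dl := derivation_chermite_l DD DM Dk Dw Dwb.
elim=> [|m IH] n; last first.
  by rewrite chermiteSl LB Lw dr !Ln !IH chermiteSl exprS; ring.
elim: n => [|n IHn]; first by rewrite /= !expr0 !mul1r.
by rewrite chermiteSr LB Lwb dl !Ln !IHn chermiteSr /=; ring.
Qed.

(** The hypotheses are integrations by parts against exp(-w wb + ub w). Raising [k'] lowers [n] in
    the other factor, which produces the Kronecker delta and the factorial; raising [m] lowers [l],
    which reproduces up to sign the recurrence of [chermite m l u ub]. *)
Lemma chermite_bargmann (u ub : F) :
  (forall p, L (w * p) = L (Db p)) ->
  (forall p, L ((wb - k ub) * p) = L (D p)) ->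
  forall m n k' l,
  L (chermite m n (w - k u) (wb - k ub) * chermite k' l w wb)
   = (n == k')%:R * n`!%:R * (-1) ^+ m * chermite m l u ub * L 1.
Proof.
move=> hw hwb.
have D0 (d : A -> A) (dD : forall p q, d (p + q) = d p + d q) (dk : forall c, d (k c) = 0) p c :
    d (p - k c) = d p by rewrite -(rmorphN k) dD dk addr0.
have dr := derivation_chermite_r DbD DbM Dbk Dbw Dbwb.
have dra : forall m n, Db (chermite m n (w - k u) (wb - k ub)) =
    n%:R * chermite m n.-1 (w - k u) (wb - k ub).
  by apply: derivation_chermite_r => //; rewrite D0.
have Lwb p : L (wb * p) = L (D p) + ub * L p by rewrite -hwb mulrBl LB LZ subrK.
have Dpow l : D (wb ^+ l) = 0.
  elim: l => [|l IH]; first by rewrite expr0 -(rmorph1 k).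
  by rewrite exprS DM Dwb IH mul0r mulr0 addr0.
have Lpow l : L (wb ^+ l) = ub ^+ l * L 1.
  elim: l => [|l IH]; first by rewrite !expr0 mul1r.
  by rewrite exprS Lwb Dpow -(rmorph0 k) -[k 0]mulr1 LZ mul0r add0r IH mulrA -exprS.
have step m n k' l : L (chermite m.+1 n (w - k u) (wb - k ub) * chermite k' l w wb)
    = l%:R * L (chermite m n (w - k u) (wb - k ub) * chermite k' l.-1 w wb)
      - u * L (chermite m n (w - k u) (wb - k ub) * chermite k' l w wb).
  rewrite chermiteSl.
  set a := chermite m n _ _; set b := chermite k' l w wb; set a' := chermite m n.-1 _ _.
  have -> : ((w - k u) * a - n%:R * a') * b = w * (a * b) - k u * (a * b) - n%:R * (a' * b).
    ring.
  rewrite !LB LZ hw DbM dra dr LD -/a' -[n%:R * a' * b]mulrA [a * (l%:R * _)]mulrCA !Ln; ring.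
move=> m n k' l; elim: k' m n l => [|k' IH] m n l; last first.
  rewrite chermiteSl.
  set a := chermite m n _ _; set b := chermite k' l w wb; set b' := chermite k' l.-1 _ _.
  have -> : a * (w * b - l%:R * b') = w * (a * b) - l%:R * (a * b') by ring.
  rewrite LB hw DbM dra dr LD -mulrA ![a * (l%:R * _)]mulrCA !Ln addrK IH.
  clear a; case: n => [|n] /=; first by rewrite !mul0r.
  by rewrite eqSS factS natrM; ring.
elim: m n l => [|m IHm] n l; last first.
  by rewrite step !IHm [in RHS]chermiteSl exprS; ring.
case: n => [|n] /=; first by rewrite !expr0 mul1r Lpow fact0; ring.
(* Here [n] is positive: one factor [wb - k ub] turns into [D], which annihilates what remains, a
   polynomial in [wb] alone. *)
rewrite exprS -mulrA hwb DM Dpow mulr0 addr0.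
have -> : D ((wb - k ub) ^+ n) = 0.
  elim: n => [|n IH]; first by rewrite expr0 -(rmorph1 k).
  by rewrite exprS DM D0 // Dwb IH mul0r mulr0 addr0.
by rewrite mul0r -(rmorph0 k) -[k 0]mulr1 LZ !mul0r.
Qed.

End Functional.

(** * Gaussian integrals over the plane *)

Section BivariatePolynomials.
Variable F : comNzRingType.
Implicit Types P Q : {poly {poly F}}.

Definition polyCC : {rmorphism F -> {poly {poly F}}} :=
  [the {rmorphism _ -> _} of (@polyC {poly F}) \o (@polyC F)].

(** The outer variable ['X] stands for the first coordinate and ['X%:P] for the second. The formal
    derivative of the outer ring is thus the partial derivative in the first coordinate, and this
    one is that in the second. *)
Definition deriv_inner P : {poly {poly F}} := map_poly (@deriv F) P.

Lemma coef_deriv_inner P i : (deriv_inner P)`_i = (P`_i)^`().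
Proof. by rewrite coef_map. Qed.

Lemma deriv_innerD P Q : deriv_inner (P + Q) = deriv_inner P + deriv_inner Q.
Proof. by rewrite /deriv_inner raddfD. Qed.

Lemma deriv_innerM P Q :
  deriv_inner (P * Q) = deriv_inner P * Q + P * deriv_inner Q.
Proof.
apply/polyP => i; rewrite coef_deriv_inner coefD !coefM raddf_sum -big_split /=.
by apply: eq_bigr => j _; rewrite derivM !coef_deriv_inner.
Qed.

Lemma deriv_innerC (p : {poly F}) : deriv_inner p%:P = p^`()%:P.
Proof. by apply/polyP => i; rewrite coef_deriv_inner !coefC; case: eqP; rewrite ?deriv0. Qed.

Lemma deriv_innerX : deriv_inner 'X = 0.
Proof.
by apply/polyP => i; rewrite coef_deriv_inner coefX coef0; case: (i == _)%N; rewrite ?deriv0 ?derivC.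
Qed.

Definition mono c i j : {poly {poly F}} := polyCC c * ('X ^+ i * 'X%:P ^+ j).

Lemma poly2_ind (T : {poly {poly F}} -> Prop) :
  T 0 -> (forall P Q, T P -> T Q -> T (P + Q)) -> (forall c i j, T (mono c i j)) ->
  forall P, T P.
Proof.
move=> T0 TD Tm P.
have -> : P = \sum_(i < size P) \sum_(j < size P`_i) mono P`_i`_j i j.
  rewrite -[LHS]coefK poly_def; apply: eq_bigr => i _.
  rewrite -[in LHS](coefK P`_i) poly_def scaler_suml; apply: eq_bigr => j _.
  by rewrite -mul_polyC -mul_polyC /mono polyCM -mulrA [_ * 'X^i]mulrC rmorphXn.
by elim/big_ind: _ => // i _; elim/big_ind: _ => // j _.
Qed.

Lemma deriv_mono c i j : (mono c i j)^`() = i%:R * mono c i.-1 j.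
Proof.
rewrite /mono !derivM derivXn -rmorphXn /= !derivC mul0r add0r mulr0 addr0.
rewrite -mulr_natl; ring.
Qed.

Lemma deriv_inner_mono c i j : deriv_inner (mono c i j) = j%:R * mono c i j.-1.
Proof.
rewrite /mono !deriv_innerM -rmorphXn /= !deriv_innerC derivC derivXn mul0r add0r.
have -> : deriv_inner 'X^i = 0.
  elim: i => [|i IH]; first by rewrite expr0 deriv_innerC derivC.
  by rewrite exprS deriv_innerM deriv_innerX IH mul0r mulr0 addr0.
rewrite mul0r add0r rmorphMn /= -mulr_natl rmorphXn /=; ring.
Qed.

Definition eval2 (x y : F) P : F := P.[x%:P].[y].

Lemma eval2D x y P Q : eval2 x y (P + Q) = eval2 x y P + eval2 x y Q.
Proof. by rewrite /eval2 !hornerD. Qed.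

Lemma eval2M x y P Q : eval2 x y (P * Q) = eval2 x y P * eval2 x y Q.
Proof. by rewrite /eval2 !hornerM. Qed.

Lemma eval2_is_monoid x y : monoid_morphism (eval2 x y).
Proof. by split=> [|P Q]; rewrite /eval2 ?hornerM // !hornerE. Qed.

Lemma eval2_is_additive x y : zmod_morphism (eval2 x y).
Proof. by move=> P Q; rewrite /eval2 !hornerE. Qed.

HB.instance Definition _ x y := GRing.isZmodMorphism.Build _ _ (eval2 x y) (@eval2_is_additive x y).
HB.instance Definition _ x y := GRing.isMonoidMorphism.Build _ _ (eval2 x y) (@eval2_is_monoid x y).

Lemma eval2C x y c : eval2 x y (polyCC c) = c.
Proof. by rewrite /eval2 /= !hornerC. Qed.

Lemma eval2X x y : eval2 x y 'X = x. Proof. by rewrite /eval2 !hornerE. Qed.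

Lemma eval2Y x y : eval2 x y 'X%:P = y. Proof. by rewrite /eval2 !hornerE. Qed.

Lemma eval2_mono x y c i j : eval2 x y (mono c i j) = c * (x ^+ i * y ^+ j).
Proof. by rewrite !rmorphM !rmorphXn /= eval2X eval2Y eval2C. Qed.

End BivariatePolynomials.

Section PlaneGaussian.
Context {R : realType}.
Local Notation C := R[i].
Local Notation leb := (@lebesgue_measure R).
Local Notation leb2 := (leb2 R).
Variables (lam : R) (lam0 : 0 < lam) (c1 c2 : C).

Definition gw2 (u : R * R) : C := gw lam c1 u.1 * gw lam c2 u.2.

Lemma cintE (f : R * R -> C) : cint f = cintegral leb2 f.
Proof. by []. Qed.

Lemma gw_integrable c i : cintegrable leb (fun x => (x ^+ i)%:C * gw lam c x).
Proof. by case: c => a b; exact: cintegrable_moment. Qed.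

Lemma mono_gw2E c i j : (fun u : R * R => eval2 u.1%:C u.2%:C (mono c i j) * gw2 u) =
  (fun u => c * (((u.1 ^+ i)%:C * gw lam c1 u.1) * ((u.2 ^+ j)%:C * gw lam c2 u.2))).
Proof.
by apply/funext => u; rewrite eval2_mono /gw2 !rmorphXn /=; ring.
Qed.

Lemma cintegrable_poly_gw2 (P : {poly {poly C}}) :
  cintegrable leb2 (fun u => eval2 u.1%:C u.2%:C P * gw2 u).
Proof.
elim/poly2_ind: P => [|P Q hP hQ|c i j].
- by under eq_fun do rewrite raddf0 mul0r; exact: cintegrable0.
- by under eq_fun do rewrite eval2D mulrDl; exact: cintegrableD.
- rewrite mono_gw2E; apply: cintegrableZ.
  exact: (cintegrable_prodM (gw_integrable c1 i) (gw_integrable c2 j)).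
Qed.

(** Integration against the Gaussian as a functional on formal polynomials, the form in which the
    abstract results on [L] apply. *)
Definition gfun2 (P : {poly {poly C}}) : C :=
  cint (fun u => eval2 u.1%:C u.2%:C P * gw2 u).

Lemma gfun2D P Q : gfun2 (P + Q) = gfun2 P + gfun2 Q.
Proof.
rewrite /gfun2 !cintE -cintegralD; try exact: cintegrable_poly_gw2.
by apply: eq_cintegral => u; rewrite eval2D mulrDl.
Qed.

Lemma gfun2Z c P : gfun2 (polyCC _ c * P) = c * gfun2 P.
Proof.
rewrite /gfun2 !cintE -cintegralZ; last exact: cintegrable_poly_gw2.
by apply: eq_cintegral => u; rewrite eval2M eval2C -[LHS]mulrA.
Qed.

Lemma gfun2_mono c i j :
  gfun2 (mono c i j) = c * (gmoment lam c1 i * gmoment lam c2 j).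
Proof.
rewrite /gfun2 mono_gw2E cintE cintegralZ; last first.
  exact: (cintegrable_prodM (gw_integrable c1 i) (gw_integrable c2 j)).
by rewrite (cintegral_prodM (gw_integrable c1 i) (gw_integrable c2 j)).
Qed.

Lemma gfun2_nat n P : gfun2 (n%:R * P) = n%:R * gfun2 P.
Proof. by rewrite -(rmorph_nat (polyCC C)) gfun2Z. Qed.

Lemma gfun20 : gfun2 0 = 0.
Proof. by have := gfun2Z 0 0; rewrite mulr0 mul0r. Qed.

(** On monomials the integral factors, and the claim becomes [gmoment_ibp] in the first
    coordinate. *)
Lemma gfun2_ibpx P : gfun2 P^`() + c1 * gfun2 P = (2 * lam)%:C * gfun2 ('X * P).
Proof.
elim/poly2_ind: P => [|P Q hP hQ|c i j].
- by rewrite mulr0 deriv0 gfun20 !mulr0 addr0.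
- by rewrite derivD mulrDr !gfun2D !mulrDr -hP -hQ; ring.
- have -> : 'X * mono c i j = mono c i.+1 j by rewrite /mono exprS; ring.
  rewrite deriv_mono gfun2_nat !gfun2_mono.
  transitivity (c * gmoment lam c2 j * (i%:R * gmoment lam c1 i.-1 + c1 * gmoment lam c1 i)).
    ring.
  by rewrite (gmoment_ibp lam0); ring.
Qed.

Lemma gfun2_ibpy P : gfun2 (deriv_inner P) + c2 * gfun2 P = (2 * lam)%:C * gfun2 ('X%:P * P).
Proof.
elim/poly2_ind: P => [|P Q hP hQ|c i j].
- by rewrite mulr0 /deriv_inner raddf0 gfun20 !mulr0 addr0.
- by rewrite deriv_innerD mulrDr !gfun2D !mulrDr -hP -hQ; ring.
- have -> : 'X%:P * mono c i j = mono c i j.+1 by rewrite /mono exprS; ring.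
  rewrite deriv_inner_mono gfun2_nat !gfun2_mono.
  transitivity (c * gmoment lam c1 i * (j%:R * gmoment lam c2 j.-1 + c2 * gmoment lam c2 j)).
    ring.
  by rewrite (gmoment_ibp lam0); ring.
Qed.

Lemma gfun21 : gfun2 1 = (pi / lam)%:C * cexp ((c1 ^+ 2 + c2 ^+ 2) * ((4 * lam)^-1)%:C).
Proof.
have -> : 1 = mono 1 0 0 :> {poly {poly C}} by rewrite /mono !expr0 !mulr1 rmorph1.
rewrite gfun2_mono !gmoment0 // mul1r [(c1 ^+ 2 + c2 ^+ 2) * _]mulrDl cexpD.
have -> : (pi / lam)%:C = (Num.sqrt (pi / lam))%:C * (Num.sqrt (pi / lam))%:C.
  by rewrite -rmorphM /= -expr2 sqr_sqrtr // divr_ge0 ?pi_ge0 // ltW.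
ring.
Qed.

End PlaneGaussian.

(** * Wirtinger derivatives of polynomials in two real variables *)

Section Wirtinger.
Variables (F : comNzRingType) (i h : F).
Hypotheses (i2 : i * i = -1) (h2 : h * 2%:R = 1).
Local Notation k := (@polyCC F).
Implicit Types P Q : {poly {poly F}}.

Definition wpoly : {poly {poly F}} := 'X - k i * 'X%:P.
Definition wbpoly : {poly {poly F}} := 'X + k i * 'X%:P.

Definition hermite_poly m n : {poly {poly F}} := chermite m n wpoly wbpoly.

Definition bargmann_poly (u ub : F) m n p q : {poly {poly F}} :=
  chermite m n (wpoly - k u) (wbpoly - k ub) * hermite_poly p q.

Let eval2k x y c : eval2 x y (k c) = c.
Proof. exact: eval2C. Qed.

Let eval2_w x y : eval2 x y wpoly = x - i * y.
Proof. by rewrite /wpoly raddfB /= (eval2M x y (k i)) eval2k eval2X eval2Y. Qed.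

Let eval2_wb x y : eval2 x y wbpoly = x + i * y.
Proof. by rewrite /wbpoly eval2D (eval2M x y (k i)) eval2k eval2X eval2Y. Qed.

Lemma eval2_hermite_poly x y m n :
  eval2 x y (hermite_poly m n) = chermite m n (x - i * y) (x + i * y).
Proof. by rewrite -eval2_w -eval2_wb; exact: rmorph_chermite. Qed.

Lemma eval2_bargmann_poly x y u ub m n p q :
  eval2 x y (bargmann_poly u ub m n p q) =
  chermite m n (x - i * y - u) (x + i * y - ub) * chermite p q (x - i * y) (x + i * y).
Proof.
rewrite /bargmann_poly eval2M eval2_hermite_poly; congr (_ * _).
rewrite -eval2_w -eval2_wb -[in RHS](eval2k x y u) -[in RHS](eval2k x y ub) -!raddfB.
exact: rmorph_chermite.
Qed.

(** As [h] is one half, [s = i] gives the Wirtinger derivative in [wpoly] and [s = - i] the one in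
    [wbpoly]. *)
Let d (s : F) P : {poly {poly F}} := k h * (P^`() + k s * deriv_inner P).

Let dD s P Q : d s (P + Q) = d s P + d s Q.
Proof.
by rewrite /d derivD deriv_innerD; move: P^`() Q^`() (deriv_inner P) (deriv_inner Q) => *; ring.
Qed.

Let dM s P Q : d s (P * Q) = d s P * Q + P * d s Q.
Proof.
by rewrite /d derivM deriv_innerM; move: P^`() Q^`() (deriv_inner P) (deriv_inner Q) => *; ring.
Qed.

Let dk s c : d s (k c) = 0.
Proof. by rewrite /d derivC deriv_innerC derivC polyC0 !mulr0 addr0 mulr0. Qed.

Let dxY c : (k c * 'X%:P)^`() = 0.
Proof. by rewrite derivM (derivC c%:P) (derivC 'X) mul0r mulr0 addr0. Qed.

Let dyY c : deriv_inner (k c * 'X%:P) = k c.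
Proof.
by rewrite deriv_innerM (deriv_innerC 'X) (deriv_innerC c%:P) derivC derivX polyC0 mul0r add0r polyC1 mulr1.
Qed.

Let d_line s t : d s ('X + k t * 'X%:P) = k (h * (1 + s * t)).
Proof.
rewrite /d derivD dxY addr0 derivX deriv_innerD deriv_innerX add0r dyY.
by rewrite !rmorphM rmorphD rmorph1 rmorphM.
Qed.

Let wE : wpoly = 'X + k (- i) * 'X%:P.
Proof. by rewrite /wpoly rmorphN mulNr. Qed.

Let dw_w : d i wpoly = 1.
Proof. by rewrite wE d_line mulrN i2 opprK h2 rmorph1. Qed.
Let dw_wb : d i wbpoly = 0.
Proof. by rewrite d_line i2 subrr mulr0 rmorph0. Qed.
Let dwb_w : d (- i) wpoly = 0.
Proof. by rewrite wE d_line mulrNN i2 subrr mulr0 rmorph0. Qed.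
Let dwb_wb : d (- i) wbpoly = 1.
Proof. by rewrite d_line mulNr i2 opprK h2 rmorph1. Qed.

Variables (L : {poly {poly F}} -> F) (lam c1 c2 : F).
Hypothesis LD : forall P Q, L (P + Q) = L P + L Q.
Hypothesis LZ : forall c P, L (k c * P) = c * L P.
Hypothesis Lx : forall P, L P^`() + c1 * L P = lam * L ('X * P).
Hypothesis Ly : forall P, L (deriv_inner P) + c2 * L P = lam * L ('X%:P * P).

Let ibp s P : lam * L (('X + k s * 'X%:P) * P) - (c1 + s * c2) * L P = 2%:R * L (d s P).
Proof.
rewrite mulrDl -mulrA LD LZ mulrDr [lam * (s * _)]mulrCA -Lx -Ly /d LZ LD LZ mulrA.
by rewrite [2%:R * h]mulrC h2; ring.
Qed.

(** [lam] is twice the rate of the Gaussian, here 1/2, and [c1], [c2] are the linear coefficients of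
    the phase [sympl v y]. *)
Lemma chermite_poly_fourier (y1 y2 : F) m n : lam = 1 -> c1 = i * y2 -> c2 = - i * y1 ->
  L (hermite_poly m n) =
    (-1) ^+ m * chermite m n (y1 - i * y2) (y1 + i * y2) * L 1.
Proof.
move=> lam1 e1 e2.
have i2' (x : F) : i * (i * x) = - x by rewrite mulrA i2 mulN1r.
apply: (chermite_fourier LD LZ (dD i) (dM i) (dk i) (dD (- i)) (dM (- i)) (dk (- i))
  dw_w dw_wb dwb_w dwb_wb) => P.
  rewrite -ibp -wE lam1 mul1r mulrDl LD LZ e1 e2; congr (_ + _).
  by rewrite -[RHS]mulNr; congr (_ * _); rewrite !mulNr mulrN opprK i2' opprD opprK addrC.
rewrite -ibp lam1 mul1r mulrBl -mulNr -rmorphN LD LZ e1 e2; congr (_ + _).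
by rewrite -[RHS]mulNr; congr (- _ * _); rewrite mulNr mulrN i2' opprK addrC.
Qed.

(** The linear exponent is [ub * (x - i * y)], free of [wb]: multiplication by [w] is a pure
    derivative, and only [wb] is shifted, by [ub]. *)
Lemma chermite_poly_bargmann (u ub : F) m n p q : lam = 2%:R -> c1 = ub -> c2 = - i * ub ->
  L (bargmann_poly u ub m n p q) =
    (n == p)%:R * n`!%:R * (-1) ^+ m * chermite m q u ub * L 1.
Proof.
move=> lam2 e1 e2.
have i2' (x : F) : i * (i * x) = - x by rewrite mulrA i2 mulN1r.
have two (x : F) : x = h * (2%:R * x) by rewrite mulrA h2 mul1r.
apply: (chermite_bargmann LD LZ (dD i) (dM i) (dk i) (dD (- i)) (dM (- i)) (dk (- i))
  dw_wb dwb_w dwb_wb u) => P; rewrite [RHS]two -ibp lam2.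
  by rewrite -wE e1 e2 !mulNr mulrN opprK i2' subrr mul0r subr0 -two.
rewrite e1 e2 mulNr mulrN i2' opprK mulrBl -mulNr -rmorphN LD LZ [LHS]two; congr (_ * _).
by rewrite -/wbpoly; ring.
Qed.

End Wirtinger.

(** * The two Gaussian integrals behind the twisted product *)

Section HermiteIntegrals.
Context {R : realType}.
Local Notation C := R[i].
Local Notation iC := (0 +i* 1 : C).
Local Notation k := (polyCC C).
Implicit Types u v w y : R * R.

(* the paper's [q - ip] and [q + ip] *)
Definition zc u : C := u.1 -i* u.2.
Definition zcb u : C := u.1 +i* u.2.

Let iC2 : iC * iC = -1.
Proof. by apply/eqP; rewrite eq_complex /=; apply/andP; split; apply/eqP; ring. Qed.

Let hC : (2^-1 : C) * 2%:R = 1.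
Proof. by rewrite mulVf // pnatr_eq0. Qed.

Let zcE u : zc u = u.1%:C - iC * u.2%:C.
Proof. by apply/eqP; rewrite eq_complex /=; apply/andP; split; apply/eqP; ring. Qed.

Let zcbE u : zcb u = u.1%:C + iC * u.2%:C.
Proof. by apply/eqP; rewrite eq_complex /=; apply/andP; split; apply/eqP; ring. Qed.

Definition gauss2 u : R := expR (- ((u.1 ^+ 2 + u.2 ^+ 2) / 2)).

Let gauss_fourier_weight v y :
  (gauss2 v)%:C * expi (sympl v y) = gw2 2^-1 (0 +i* y.2) (0 -i* y.1) v.
Proof.
rewrite /gauss2 -cexpR cexp_expi /gw2 /gw -!cexpD; congr cexp.
by apply/eqP; rewrite eq_complex /= /sympl; apply/andP; split; apply/eqP; field.
Qed.

(** The eigenfunction property under the symplectic Fourier transform, which evaluates the inner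
    integral of the twisted product. *)
Lemma hermite_fourier m n y :
  cint (fun v => chermite m n (zc v) (zcb v) * (gauss2 v)%:C * expi (sympl v y)) =
  (2 * pi)%:C * (-1) ^+ m * chermite m n (zc y) (zcb y) * (gauss2 y)%:C.
Proof.
have l0 : 0 < 2^-1 :> R by rewrite invr_gt0.
pose L := gfun2 2^-1 (0 +i* y.2) (0 -i* y.1).
have lam1 : (2 * 2^-1 : R)%:C = 1 by rewrite mulfV // pnatr_eq0.
have e1 : 0 +i* y.2 = iC * y.2%:C.
  by apply/eqP; rewrite eq_complex /=; apply/andP; split; apply/eqP; ring.
have e2 : 0 -i* y.1 = - iC * y.1%:C.
  by apply/eqP; rewrite eq_complex /=; apply/andP; split; apply/eqP; ring.
have E := chermite_poly_fourier (F := R[i]) iC2 hC (gfun2D l0 _ _) (gfun2Z l0 _ _) (gfun2_ibpx l0 _ _)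
  (gfun2_ibpy l0 _ _) m n lam1 e1 e2.
transitivity (L (hermite_poly iC m n)).
  apply: eq_cintegral => v.
  by rewrite eval2_hermite_poly -zcE -zcbE -mulrA gauss_fourier_weight.
rewrite /L {}E -zcE -zcbE gfun21 // invrK [pi * 2]mulrC.
have -> : cexp (((0 +i* y.2) ^+ 2 + (0 -i* y.1) ^+ 2) * ((4 / 2)^-1)%:C) = (gauss2 y)%:C.
  rewrite /gauss2 -cexpR; congr cexp.
  by apply/eqP; rewrite eq_complex /=; apply/andP; split; apply/eqP; field.
ring.
Qed.

Lemma hermite_fourier_integrable m n y :
  cintegrable (leb2 R) (fun v => chermite m n (zc v) (zcb v) * (gauss2 v)%:C * expi (sympl v y)).
Proof.
have l0 : 0 < 2^-1 :> R by rewrite invr_gt0.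
apply: eq_cintegrable (cintegrable_poly_gw2 l0 (0 +i* y.2) (0 -i* y.1) (hermite_poly iC m n)) => v.
by rewrite eval2_hermite_poly -zcE -zcbE -mulrA gauss_fourier_weight.
Qed.

(** The cross term of the shifted Gaussian and the phase merge into [zcb u * zc w], which leaves the
    constant [gauss2 u] outside. *)
Let bargmann_weight w u : (gauss2 (w - u))%:C * (gauss2 w)%:C * expi (sympl w u) =
  (gauss2 u)%:C * gw2 1 (zcb u) (- iC * zcb u) w.
Proof.
rewrite /gauss2 -!cexpR cexp_expi /gw2 /gw -!cexpD; congr cexp.
by apply/eqP; rewrite eq_complex /= /sympl; apply/andP; split; apply/eqP; field.
Qed.

Let zcB w u : zc (w - u) = zc w - zc u.
Proof. by apply/eqP; rewrite eq_complex /=; apply/andP; split; apply/eqP; ring. Qed.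
Let zcbB w u : zcb (w - u) = zcb w - zcb u.
Proof. by apply/eqP; rewrite eq_complex /=; apply/andP; split; apply/eqP; ring. Qed.

Let bargmann_integrand u m n p q w :
  chermite m n (zc (w - u)) (zcb (w - u)) * (gauss2 (w - u))%:C *
    (chermite p q (zc w) (zcb w) * (gauss2 w)%:C) * expi (sympl w u) =
  (gauss2 u)%:C * (eval2 w.1%:C w.2%:C
     (bargmann_poly iC (zc u) (zcb u) m n p q)
     * gw2 1 (zcb u) (- iC * zcb u) w).
Proof.
rewrite eval2_bargmann_poly -zcE -zcbE zcB zcbB.
rewrite [RHS]mulrCA -bargmann_weight; ring.
Qed.

Lemma hermite_bargmann_integrable m n p q u : cintegrable (leb2 R) (fun w =>
  chermite m n (zc (w - u)) (zcb (w - u)) * (gauss2 (w - u))%:C *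
    (chermite p q (zc w) (zcb w) * (gauss2 w)%:C) * expi (sympl w u)).
Proof.
under eq_fun do rewrite bargmann_integrand.
by apply: cintegrableZ; apply: cintegrable_poly_gw2.
Qed.

Lemma hermite_bargmann m n p q u :
  cint (fun w => chermite m n (zc (w - u)) (zcb (w - u)) * (gauss2 (w - u))%:C *
    (chermite p q (zc w) (zcb w) * (gauss2 w)%:C) * expi (sympl w u)) =
  pi%:C * ((n == p)%:R * n`!%:R * (-1) ^+ m) * chermite m q (zc u) (zcb u) * (gauss2 u)%:C.
Proof.
pose L := gfun2 1 (zcb u) (- iC * zcb u).
have l0 : 0 < 1 :> R by [].
have lam2 : (2 * 1 : R)%:C = 2%:R by rewrite mulr1 rmorph_nat.
have E := chermite_poly_bargmann (F := R[i]) iC2 hC (gfun2D l0 _ _) (gfun2Z l0 _ _) (gfun2_ibpx l0 _ _)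
  (gfun2_ibpy l0 _ _) (zc u) m n p q lam2 (erefl (zcb u)) erefl.
transitivity ((gauss2 u)%:C * L (bargmann_poly iC (zc u) (zcb u) m n p q)).
  rewrite /L /gfun2 cintE -cintegralZ; last exact: cintegrable_poly_gw2.
  by apply: eq_cintegral => w; rewrite bargmann_integrand.
rewrite /L {}E gfun21 // invr1 mulr1.
(* The linear coefficient is an isotropic vector, so completing the square contributes nothing and
   the total mass is [pi]. *)
have -> : zcb u ^+ 2 + (- iC * zcb u) ^+ 2 = 0.
  by rewrite mulNr sqrrN exprMn !expr2 iC2 mulN1r subrr.
by rewrite mul0r cexp0; ring.
Qed.

End HermiteIntegrals.

(** * Twisted Hermite functions *)

Section TwistedHermite.
Context {R : realType}.
Local Notation C := R[i].
Implicit Types (u v w y : R * R) (a b : nat -> nat -> C).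
Local Notation tw := (@twisted_hermite R).

Definition hcoef (m n : nat) : R := 2 / Num.sqrt ((m`! * n`!)%:R).

Lemma zcM u : zc u * zcb u = (u.1 ^+ 2 + u.2 ^+ 2)%:C.
Proof. by apply/eqP; rewrite eq_complex /=; apply/andP; split; apply/eqP; ring. Qed.

(** Summing the explicit formula backwards, with [k = n - j], leaves the power [j] of [zcb u], which
    pairs with as many factors [zc u] into a power of [u.1 ^+ 2 + u.2 ^+ 2]. *)
Lemma chermite_laguerre m n u : (n <= m)%N ->
  chermite m n (zc u) (zcb u) = ((-1) ^+ n * n`!%:R)%:C * zc u ^+ (m - n) *
    (laguerre n (m - n) (u.1 ^+ 2 + u.2 ^+ 2))%:C.
Proof.
move=> nm; rewrite chermite_explicit /laguerre (reindex_inj rev_ord_inj) /=.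
rewrite rmorph_sum mulr_sumr; apply: eq_bigr => j _ /=.
have jn : (j <= n)%N by rewrite -ltnS.
rewrite subSS subKn // subnKC //.
have -> : (m - (n - j) = (m - n) + j)%N by lia.
have zz : ((u.1 ^+ 2 + u.2 ^+ 2) ^+ j)%:C = zc u ^+ j * zcb u ^+ j.
  by rewrite -exprMn zcM rmorphXn.
rewrite exprD.
have -> : 'C(n, n - j) = 'C(n, j) by rewrite bin_sub.
have fj : (j`!%:R : R) != 0 by rewrite pnatr_eq0 -lt0n fact_gt0.
have E : ((n - j)`! * 'C(m, n - j) * 'C(n, j))%:R = n`!%:R * 'C(m, n - j)%:R / j`!%:R :> R.
  have <- := bin_fact jn; rewrite !natrM; field; exact: fj.
have -> : ((n - j)`! * 'C(m, n - j) * 'C(n, j))%:R = (n`!%:R * 'C(m, n - j)%:R / j`!%:R : R)%:C :> C.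
  by rewrite -E rmorph_nat.
have -> : (-1) ^+ (n - j) = (((-1) ^+ n * (-1) ^+ j) : R)%:C :> C.
  rewrite -signr_odd oddB // -[in RHS](signr_odd _ n) -[in RHS](signr_odd _ j).
  by case: (odd n) (odd j) => [] []; rewrite /= !(expr0, expr1, mulr1, mul1r, mulrNN, rmorph1, rmorphN1).
by rewrite !rmorphM /= zz; ring.
Qed.

Lemma hcoefC m n : hcoef m n = hcoef n m.
Proof. by rewrite /hcoef mulnC. Qed.

(** Removes the case split of the definition: conjugation swaps [zc] and [zcb], hence the two
    indices of [chermite]. *)
Lemma twisted_hermiteE m n u :
  tw m n u = (hcoef m n)%:C * (chermite m n (zc u) (zcb u) * (gauss2 u)%:C).
Proof.
have low p q : (q <= p)%N -> hermite_lower p q u =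
    (hcoef p q)%:C * (chermite p q (zc u) (zcb u) * (gauss2 u)%:C).
  move=> qp; rewrite chermite_laguerre // /hermite_lower -/(zc u) /gauss2.
  have fq : (q`!%:R : R) != 0 by rewrite pnatr_eq0 -lt0n fact_gt0.
  have fp : (p`!%:R : R) != 0 by rewrite pnatr_eq0 -lt0n fact_gt0.
  have -> : Num.sqrt (q`!%:R / p`!%:R) = q`!%:R / Num.sqrt (p`! * q`!)%:R :> R.
    have -> : (q`!%:R / p`!%:R : R) = q`!%:R ^+ 2 / (p`! * q`!)%:R.
      by rewrite natrM; field; rewrite fp fq.
    by rewrite sqrtrM ?sqr_ge0 // sqrtr_sqr sqrtrV ?ler0n // ger0_norm.
  rewrite /hcoef !rmorphM /=; ring.
rewrite /twisted_hermite; case: leqP => [|/ltnW] h; first exact: low.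
rewrite low // chermite_sym hcoefC.
have cR (x : R) : conjc x%:C = x%:C by rewrite /= oppr0.
have cM (x y : C) : conjc (x * y) = conjc x * conjc y by exact: rmorphM.
rewrite !cM !cR (rmorph_chermite (@conjc R)) /=.
by rewrite /zc /zcb /= opprK.
Qed.

End TwistedHermite.

(** * Twisted products and norms of finite Hermite sums *)

Section HermiteSums.
Context {R : realType}.
Local Notation C := R[i].
Local Notation leb2 := (leb2 R).
Implicit Types (u v w y : R * R) (a b : nat -> nat -> C).
Local Notation tw := (@twisted_hermite R).

Lemma twisted_hermite_conj m n u : conjc (tw m n u) = tw n m u.
Proof.
have cR (x : R) : conjc x%:C = x%:C by rewrite /= oppr0.
have cM (x y : C) : conjc (x * y) = conjc x * conjc y by exact: rmorphM.
rewrite !twisted_hermiteE !cM !cR (rmorph_chermite (@conjc R)) /= chermite_sym hcoefC.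
by rewrite /zc /zcb /= opprK.
Qed.

Lemma twisted_hermite_integrable m n y :
  cintegrable leb2 (fun v => tw m n v * expi (sympl v y)).
Proof.
under eq_fun do rewrite twisted_hermiteE -mulrA.
exact/cintegrableZ/hermite_fourier_integrable.
Qed.

Lemma twisted_hermite_fourier m n y :
  cint (fun v => tw m n v * expi (sympl v y)) = (2 * pi)%:C * (-1) ^+ m * tw m n y.
Proof.
transitivity ((hcoef m n)%:C * cint (fun v => chermite m n (zc v) (zcb v) *
    (gauss2 v)%:C * expi (sympl v y))).
  rewrite !cintE -cintegralZ; last exact: hermite_fourier_integrable.
  by apply: eq_cintegral => v; rewrite twisted_hermiteE -mulrA.
by rewrite hermite_fourier twisted_hermiteE; ring.
Qed.

Let bargE m n p q u w : tw m n (w - u) * tw p q w * expi (sympl w u) =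
  (hcoef m n * hcoef p q)%:C * (chermite m n (zc (w - u)) (zcb (w - u)) * (gauss2 (w - u))%:C *
    (chermite p q (zc w) (zcb w) * (gauss2 w)%:C) * expi (sympl w u)).
Proof.
have hM (x y : R) : (x * y)%:C = x%:C * y%:C by rewrite rmorphM.
by rewrite !twisted_hermiteE hM; ring.
Qed.

Lemma twisted_hermite_shift_integrable m n p q u :
  cintegrable leb2 (fun w => tw m n (w - u) * tw p q w * expi (sympl w u)).
Proof.
under eq_fun do rewrite bargE.
exact/cintegrableZ/hermite_bargmann_integrable.
Qed.

Lemma twisted_hermite_shift m n p q u :
  cint (fun w => tw m n (w - u) * tw p q w * expi (sympl w u)) =
  (2 * pi)%:C * (-1) ^+ m * ((n == p)%:R * tw m q u).
Proof.
under [LHS]eq_cintegral do rewrite bargE.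
rewrite cintegralZ; last exact: hermite_bargmann_integrable.
rewrite -cintE hermite_bargmann twisted_hermiteE.
have [<-|_] := eqVneq n p; last by rewrite !mul0r !mulr0 !mul0r !mulr0.
have f0 j : 0 < (j`!%:R : R) by rewrite ltr0n fact_gt0.
have s0 j : Num.sqrt (j`!%:R : R) != 0 by rewrite gt_eqF // sqrtr_gt0.
have sE j : (j`!%:R : R) = Num.sqrt j`!%:R ^+ 2 by rewrite sqr_sqrtr // ltW.
(* The factorial produced by [hermite_bargmann] cancels the two factors [1 / sqrt n!] of the
   normalizations. *)
have E : hcoef m n * hcoef n q * (pi * n`!%:R) = 2 * pi * hcoef m q :> R.
  rewrite /hcoef !natrM !sqrtrM ?ler0n // [n`!%:R in X in _ * (_ * X)]sE.
  by field; rewrite !s0.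
have -> : (hcoef m n * hcoef n q)%:C * (pi%:C * (1%:R * n`!%:R * (-1) ^+ m) *
    chermite m q (zc u) (zcb u) * (gauss2 u)%:C) =
  (hcoef m n * hcoef n q * (pi * n`!%:R))%:C * ((-1) ^+ m *
    chermite m q (zc u) (zcb u) * (gauss2 u)%:C).
  have fC : (n`!%:R : R)%:C = n`!%:R :> C by rewrite rmorph_nat.
  by rewrite -fC !rmorphM /=; ring.
by rewrite E !rmorphM /=; ring.
Qed.

Definition hsum (N : nat) a u : C := \sum_(m < N) \sum_(n < N) a m n * tw m n u.

Lemma hsum_pair N a u :
  hsum N a u = \sum_(p : 'I_N * 'I_N) a p.1 p.2 * tw p.1 p.2 u.
Proof. by rewrite /hsum pair_bigA. Qed.

Lemma hsum_fourier_integrable N a y :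
  cintegrable leb2 (fun v => hsum N a v * expi (sympl v y)).
Proof.
under eq_fun do rewrite hsum_pair mulr_suml.
apply: cintegrable_sum => p; under eq_fun do rewrite -mulrA.
exact/cintegrableZ/twisted_hermite_integrable.
Qed.

Lemma hsum_fourier N a y : cint (fun v => hsum N a v * expi (sympl v y)) =
  (2 * pi)%:C * \sum_(p : 'I_N * 'I_N) (-1) ^+ p.1 * (a p.1 p.2 * tw p.1 p.2 y).
Proof.
under [LHS]eq_cintegral do rewrite hsum_pair mulr_suml.
rewrite cintegral_sum => [|p]; last first.
  under eq_fun do rewrite -mulrA.
  exact/cintegrableZ/twisted_hermite_integrable.
rewrite mulr_sumr; apply: eq_bigr => p _.
under [LHS]eq_cintegral do rewrite -mulrA.
rewrite cintegralZ; last exact: twisted_hermite_integrable.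
by rewrite -cintE twisted_hermite_fourier; ring.
Qed.

Lemma twisted_hsum N a b :
  twisted (hsum N a) (hsum N b) = hsum N (fun m l => \sum_(n < N) a m n * b n l).
Proof.
apply/funext => u; rewrite /twisted.
(* As a function of [v] the phase is [sympl v (w - u)] plus a constant, so [hsum_fourier] applies at
   the point [w - u]. *)
have inner w : cint (fun v => hsum N a v * hsum N b w *
      expi (sympl u v + sympl v w + sympl w u)) =
    \sum_(p : 'I_N * 'I_N) \sum_(q : 'I_N * 'I_N)
     ((2 * pi)%:C * (-1) ^+ p.1 * (a p.1 p.2 * b q.1 q.2)) *
     (tw p.1 p.2 (w - u) * tw q.1 q.2 w * expi (sympl w u)).
  transitivity (hsum N b w * expi (sympl w u) *
      cint (fun v => hsum N a v * expi (sympl v (w - u)))).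
    rewrite !cintE -cintegralZ; last exact: hsum_fourier_integrable.
    apply: eq_cintegral => v.
    have -> : sympl u v + sympl v w + sympl w u = sympl w u + sympl v (w - u).
      by rewrite /sympl /=; ring.
    by rewrite expiD; ring.
  rewrite hsum_fourier hsum_pair !mulr_sumr; apply: eq_bigr => p _.
  by rewrite !mulr_suml; apply: eq_bigr => q _; ring.
under [X in _ * X]eq_cintegral do rewrite inner.
have I (p q : 'I_N * 'I_N) : cintegrable leb2 (fun w =>
     ((2 * pi)%:C * (-1) ^+ p.1 * (a p.1 p.2 * b q.1 q.2)) *
     (tw p.1 p.2 (w - u) * tw q.1 q.2 w * expi (sympl w u))).
  exact/cintegrableZ/twisted_hermite_shift_integrable.
rewrite cintegral_sum; last by move=> p; exact: cintegrable_sum.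
rewrite mulr_sumr; transitivity (\sum_(p : 'I_N * 'I_N) \sum_(l < N)
    (a p.1 p.2 * b p.2 l) * tw p.1 l u); last first.
  rewrite /hsum -(pair_bigA _ (fun m n : 'I_N => \sum_(l < N) a m n * b n l * tw m l u)) /=.
  apply: eq_bigr => m _; rewrite exchange_big; apply: eq_bigr => l _ /=.
  by rewrite mulr_suml.
apply: eq_bigr => p _.
rewrite cintegral_sum // mulr_sumr -(pair_bigA _ (fun k l : 'I_N => (4 * pi ^+ 2)^-1%:C *
  cintegral leb2 (fun w => ((2 * pi)%:C * (-1) ^+ p.1 * (a p.1 p.2 * b k l)) *
     (tw p.1 p.2 (w - u) * tw k l w * expi (sympl w u))))) /=.
have E (k l : 'I_N) : (4 * pi ^+ 2)^-1%:C *
    cintegral leb2 (fun w => ((2 * pi)%:C * (-1) ^+ p.1 * (a p.1 p.2 * b k l)) *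
     (tw p.1 p.2 (w - u) * tw k l w * expi (sympl w u))) =
   (p.2 == k)%:R * (a p.1 p.2 * b p.2 l * tw p.1 l u).
  rewrite cintegralZ; last exact: twisted_hermite_shift_integrable.
  rewrite -cintE twisted_hermite_shift.
  have [->|nk] := eqVneq p.2 k; last first.
    by rewrite (_ : (p.2 == k :> nat) = false) ?(mul0r, mulr0) ?mul0r //; exact/negbTE.
  have p0 : (pi : R) != 0 by rewrite gt_eqF // pi_gt0.
  (* Inner and outer integral each give [2 * pi] and the sign [(-1) ^+ p.1]; the prefactor cancels
     the former and the signs cancel each other. *)
  have pC : (4 * pi ^+ 2)^-1%:C * ((2 * pi)%:C * (2 * pi)%:C) = 1 :> C.
    have hM (x y : R) : (x * y)%:C = x%:C * y%:C by rewrite rmorphM.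
    have e : (4 * pi ^+ 2)^-1 * ((2 * pi) * (2 * pi)) = 1 :> R.
      by move: (pi : R) p0 => x x0; field; exact: x0.
    by rewrite -!hM e.
  have ss : (-1) ^+ p.1 * (-1) ^+ p.1 = 1 :> C by rewrite -expr2 sqrr_sign.
  rewrite eqxx !mul1r; set A := a _ _ * _; set X := tw _ _ _.
  set K := _%:C in pC *; set P := _%:C in pC *; set s := _ ^+ _ in ss *.
  transitivity (K * (P * P) * (s * s) * (A * X)); first by ring.
  by rewrite pC ss !mul1r.
under eq_bigr do under eq_bigr do rewrite E.
rewrite (bigD1 p.2) //= [X in _ + X]big1 ?addr0 => [|k kp].
  by apply: eq_bigr => l _; rewrite eqxx mul1r.
by apply: big1 => l _; rewrite eq_sym (negbTE kp) mul0r.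
Qed.

Lemma twisted_hermite_ortho m n p q :
  cintegrable leb2 (fun u => tw m n u * conjc (tw p q u)) /\
  cint (fun u => tw m n u * conjc (tw p q u)) = ((m == p) && (n == q))%:R * (4 * pi)%:C.
Proof.
have E w : tw m n w * conjc (tw p q w) = tw m n (w - 0) * tw q p w * expi (sympl w 0).
  by rewrite subr0 twisted_hermite_conj /sympl /= !mulr0 subrr /expi cos0 sin0 mulr1.
split; first by under eq_fun do rewrite E; exact: twisted_hermite_shift_integrable.
under [LHS]eq_cintegral do rewrite E.
rewrite -cintE twisted_hermite_shift twisted_hermiteE.
have z0 : zc (0 : R * R) = 0 by rewrite /zc /= oppr0.
have zb0 : zcb (0 : R * R) = 0 by [].
have g0 : gauss2 (0 : R * R) = 1 by rewrite /gauss2 /= expr0n addr0 mul0r oppr0 expR0.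
(* At the origin the recurrence loses its first term and lowers both indices together, so only the
   diagonal survives. *)
have ch0 : chermite m p (0 : C) 0 = (m == p)%:R * ((-1) ^+ m * m`!%:R).
  elim: m p {E} => [|m' IH] p' /=; first by rewrite expr0n fact0 !mulr1 eq_sym.
  rewrite mul0r IH; case: p' => [|p'] /=; first by rewrite !mul0r subr0.
  rewrite eqSS; have [<-|_] := eqVneq m' p'; last by rewrite !mul0r mulr0 subr0.
  by rewrite exprS factS natrM; ring.
rewrite z0 zb0 g0 ch0 mulr1 andbC; have [_|_] := eqVneq n q; last by rewrite !mul0r mulr0.
have [<-|_] := eqVneq m p; last by rewrite !mul0r !mulr0.
have f0 j : 0 < (j`!%:R : R) by rewrite ltr0n fact_gt0.
have -> : hcoef m m = 2 / m`!%:R :> R.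
  by rewrite /hcoef natrM -expr2 sqrtr_sqr ger0_norm // ltW.
have fC : (m`!%:R : R)%:C = m`!%:R :> C by rewrite rmorph_nat.
rewrite -fC /= !mul1r.
have pC : (2 * pi)%:C * ((2 / m`!%:R)%:C * (m`!%:R)%:C) = (4 * pi)%:C :> C.
  have hM (x y : R) : (x * y)%:C = x%:C * y%:C by rewrite rmorphM.
  by rewrite -!hM; congr (_ %:C); field; rewrite gt_eqF.
have ss : (-1) ^+ m * (-1) ^+ m = 1 :> C by rewrite -expr2 sqrr_sign.
by rewrite -[RHS]pC -[RHS]mulr1 -[in RHS]ss; ring.
Qed.

Lemma normc_sqr (z : C) : (normc z ^+ 2)%:C = z * conjc z.
Proof.
case: z => x y /=; rewrite sqr_sqrtr ?addr_ge0 ?sqr_ge0 //.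
by apply/eqP; rewrite eq_complex /=; apply/andP; split; apply/eqP; ring.
Qed.

(** Parseval for finite sums; the factor [4 * pi] appears because [leb2] is not normalized. *)
Lemma hsum_norm N a :
  (\int[leb2]_u (normc (hsum N a u) ^+ 2)%:E =
   (4 * pi * \sum_(p : 'I_N * 'I_N) normc (a p.1 p.2) ^+ 2)%:E)%E.
Proof.
have cM (x y : C) : conjc (x * y) = conjc x * conjc y by exact: rmorphM.
have E u : (normc (hsum N a u) ^+ 2)%:C = \sum_(p : 'I_N * 'I_N) \sum_(q : 'I_N * 'I_N)
    (a p.1 p.2 * conjc (a q.1 q.2)) * (tw p.1 p.2 u * conjc (tw q.1 q.2 u)).
  rewrite normc_sqr hsum_pair (rmorph_sum (@conjc R)) mulr_suml; apply: eq_bigr => p _.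
  by rewrite mulr_sumr; apply: eq_bigr => q _ /=; rewrite cM; ring.
have I (p q : 'I_N * 'I_N) : cintegrable leb2 (fun u => (a p.1 p.2 * conjc (a q.1 q.2)) *
    (tw p.1 p.2 u * conjc (tw q.1 q.2 u))).
  by apply: cintegrableZ; have [] := twisted_hermite_ortho p.1 p.2 q.1 q.2.
have [iR _] : cintegrable leb2 (fun u => (normc (hsum N a u) ^+ 2)%:C).
  under eq_fun do rewrite E.
  by apply: cintegrable_sum => p; exact: cintegrable_sum.
have V : cint (fun u => (normc (hsum N a u) ^+ 2)%:C) =
    (4 * pi * \sum_(p : 'I_N * 'I_N) normc (a p.1 p.2) ^+ 2)%:C.
  under [LHS]eq_cintegral do rewrite E.
  rewrite cintegral_sum; last by move=> p; exact: cintegrable_sum.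
  rewrite rmorphM rmorph_sum mulr_sumr; apply: eq_bigr => p _ /=.
  rewrite cintegral_sum // normc_sqr (bigD1 p) //= [X in _ + X]big1 ?addr0 => [|q qp].
    rewrite cintegralZ; last by have [] := twisted_hermite_ortho p.1 p.2 p.1 p.2.
    by have [_] := twisted_hermite_ortho p.1 p.2 p.1 p.2; rewrite cintE => ->; rewrite !eqxx mul1r mulrC.
  rewrite cintegralZ; last by have [] := twisted_hermite_ortho p.1 p.2 q.1 q.2.
  have [_] := twisted_hermite_ortho p.1 p.2 q.1 q.2; rewrite cintE => ->.
  rewrite (_ : _ && _ = false) ?mul0r ?mulr0 //.
  apply/negbTE; apply: contra qp => /andP[/eqP h1 /eqP h2].
  by case: p q h1 h2 => [? ?] [? ?] /= /val_inj -> /val_inj ->.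
have := integrable_fin_num measurableT iR.
move=> /fineK <-; congr EFin.
by have := congr1 (@complex.Re R) V.
Qed.

End HermiteSums.

(** * Completeness of L2 *)

Section L2Complete.
Context {R : realType} d {T : measurableType d} (mu : {measure set T -> \bar R}).

Lemma geometric_diff_cvg (a : nat -> R) (M : R) :
  (forall j, `|a j.+1 - a j| <= M * 2^-1 ^+ j) -> cvgn a.
Proof.
move=> h.
have h0 : cvgn (series (fun j => a j.+1 - a j)).
  apply: (@normed_cvg R R^o).
  apply: (@series_le_cvg _ _ (fun j => M * 2^-1 ^+ j)) => [n|n|n|].
  - exact: normr_ge0.
  - exact: le_trans (h n).
  - exact: h.
  - apply: (@is_cvg_geometric_series _ M 2^-1).
    by rewrite ger0_norm ?invr_ge0 // invf_lt1 // ltr1n.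
have E n : a n = a 0%N + series (fun j => a j.+1 - a j) n.
  by rewrite /series /= telescope_sumr // addrC subrK.
rewrite (_ : a = (fun n => a 0%N + series (fun j => a j.+1 - a j) n)); last exact/funext.
by apply: is_cvgD => //; exact: is_cvg_cst.
Qed.

(** Riesz-Fischer: a fast subsequence converges almost everywhere because a weighted series of its
    squared increments is integrable, and Fatou carries the Cauchy estimate over to its limit. *)
Lemma L2_complete_real (F : nat -> T -> R) :
  (forall n, measurable_fun setT (F n)) ->
  (forall e : R, 0 < e -> exists N, forall m n, (N <= m)%N -> (N <= n)%N ->
     (\int[mu]_x ((F m x - F n x) ^+ 2)%:E <= e%:E)%E) ->
  exists2 f : T -> R, measurable_fun setT f &
    forall e : R, 0 < e -> exists N, forall m, (N <= m)%N ->
     (\int[mu]_x ((F m x - f x) ^+ 2)%:E <= e%:E)%E.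
Proof.
move=> mF cF.
have m2 (g h : T -> R) : measurable_fun setT g -> measurable_fun setT h ->
    measurable_fun setT (fun x => ((g x - h x) ^+ 2)%:E).
  by move=> mg mh; apply/measurable_EFinP; apply: measurable_funX; exact: measurable_funB.
(* Squared increments below 8^-j leave 2^-j after the weight 4^j in [D], so [G] is integrable; where
   [G] is finite, that weight makes the increments of order 2^-j. *)
have /choice[N0 hN0] : forall j, exists N, forall m n, (N <= m)%N -> (N <= n)%N ->
     (\int[mu]_x ((F m x - F n x) ^+ 2)%:E <= ((8^-1 : R) ^+ j)%:E)%E.
  by move=> j; apply: cF; rewrite exprn_gt0 // invr_gt0.
(* Partial sums make [s] nondecreasing and at least [N0 j]; the successors make it at least [j]. *)
pose s j := (\sum_(i < j.+1) (N0 i).+1)%N.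
have sN j : (N0 j <= s j)%N by rewrite /s big_ord_recr /= addnS ltnW // ltnS leq_addl.
have sj j : (j <= s j)%N.
  rewrite (@leq_trans (\sum_(i < j.+1) 1)%N) ?leq_sum //.
  by rewrite sum1_card card_ord.
have sS j : (s j <= s j.+1)%N by rewrite /s [in leqRHS]big_ord_recr /= leq_addr.
have ss i j : (i <= j)%N -> (s i <= s j)%N.
  by move=> ij; apply: (homo_leq (@leqnn) leq_trans sS).
pose D j x : \bar R := ((4 ^+ j : R) * (F (s j.+1) x - F (s j) x) ^+ 2)%:E.
have D0 j x : (0 <= D j x)%E by rewrite lee_fin mulr_ge0 ?sqr_ge0 // exprn_ge0.
have mD j : measurable_fun setT (D j).
  apply/measurable_EFinP; apply: measurable_funM => //.
  by apply/measurable_EFinP; exact: m2.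
pose G x := (\sum_(j <oo) D j x)%E.
have mG : measurable_fun setT G by exact: ge0_emeasurable_sum.
have IG : (\int[mu]_x G x < +oo)%E.
  rewrite integral_nneseries //.
  apply: (@le_lt_trans _ _ (\sum_(j <oo) ((2 : R) / (2 ^ (j + 1))%:R)%:E)%E); last first.
    by rewrite (cvg_lim _ (@cvg_geometric_eseries_half R 2 0)) ?ltry.
  apply: lee_nneseries => [j _ _|j _]; first exact: integral_ge0.
  rewrite /D; under eq_integral do rewrite EFinM.
  rewrite ge0_integralZl_EFin; [|exact: measurableT|
    by move=> x _; rewrite lee_fin sqr_ge0|exact: m2|exact: exprn_ge0].
  apply: (@le_trans _ _ ((4 ^+ j : R)%:E * ((8^-1 : R) ^+ j)%:E)%E).
    rewrite lee_pmul2l ?lte_fin ?exprn_gt0 //.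
    by apply: hN0; rewrite ?sN // (leq_trans (sN j)).
  rewrite -EFinM lee_fin -exprMn addn1 expnS natrM invfM mulrA divff ?mul1r //.
  rewrite natrX -exprVn le_eqVlt; apply/orP; left; apply/eqP; congr (_ ^+ _).
  by field.
have aeG : {ae mu, forall x, G x \is a fin_num}.
  have : mu.-integrable setT G.
    apply/integrableP; split => //.
    by under eq_integral do rewrite gee0_abs ?nneseries_ge0 //.
  move=> /(integrable_ae measurableT); apply: filterS => x; exact.
have cG x : G x \is a fin_num -> cvgn (fun j => F (s j) x).
  move=> Gx; apply: (@geometric_diff_cvg _ (Num.sqrt (fine (G x)))) => j.
  rewrite -sqrtr_sqr; have -> : 2^-1 ^+ j = Num.sqrt ((4^-1) ^+ j) :> R.
    transitivity (Num.sqrt ((2^-1 ^+ j) ^+ 2) : R).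
      by rewrite sqrtr_sqr ger0_norm // exprn_ge0 // invr_ge0.
    by rewrite -exprM mulnC exprM expr2 -invfM -natrM.
  rewrite -sqrtrM; last by rewrite fine_ge0 // nneseries_ge0.
  rewrite ler_wsqrtr // exprVn ler_pdivlMr ?exprn_gt0 // mulrC.
  rewrite -lee_fin fineK //; apply: le_trans (nneseries_lim_ge j.+1 _) => //.
  by rewrite big_nat_recr //= leeDr // sume_ge0.
(* The upper limit is measurable everywhere, so the set of convergence need not be cut out; off that
   set the value of [f] does not matter. *)
pose f x := fine (limn_esup (fun j => (F (s j) x)%:E)).
have mf : measurable_fun setT f.
  apply: (measurableT_comp (fine_measurable measurableT)).
  by apply: measurable_fun_limn_esup => j; exact/measurable_EFinP.
have cf x : G x \is a fin_num -> (fun j => F (s j) x) @ \oo --> f x.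
  move=> /cG c; suff -> : f x = limn (fun j => F (s j) x) by [].
  rewrite /f (cvg_limn_einf_sup
    (_ : (fun j => (F (s j) x)%:E) @ \oo --> (limn (fun j => F (s j) x))%:E)).2 //.
  by apply: cvg_EFin => //; exact: nearW.
exists f => // e e0; have [N hN] := cF e e0; exists N => m Nm.
(* The shift by [N] puts every index of the subsequence in the range of the Cauchy estimate; Fatou
   is applied in [j]. *)
pose H j x : \bar R := ((F m x - F (s (j + N)%N) x) ^+ 2)%:E.
have mH j : measurable_fun setT (H j) by exact: m2.
have H0 j x : setT x -> (0 <= H j x)%E by move=> _; rewrite lee_fin sqr_ge0.
apply: (@le_trans _ _ (\int[mu]_x limn_einf (H^~ x))%E).
  apply: ae_ge0_le_integral => //.
  - by move=> x _; rewrite lee_fin sqr_ge0.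
  - exact: m2.
  - move=> x _; rewrite limn_einf_lim; apply: lime_ge; first exact: is_cvg_einfs.
    by apply: nearW => n; apply: le_ereal_inf_tmp => _ [k _ <-]; exact: H0.
  - rewrite (_ : (fun x => _) = (fun x => - limn_esup (fun j => - H j x))%E); last first.
      by apply/funext => x; rewrite limn_esupN oppeK.
    have ml : measurable_fun setT (fun x => limn_esup (fun j => - H j x)%E).
      by apply: measurable_fun_limn_esup => j; exact: measurableT_comp.
    exact: (measurableT_comp _ ml).
  apply: filterS aeG => x Gx _.
  have cH : H^~ x @ \oo --> ((F m x - f x) ^+ 2)%:E.
    apply: cvg_EFin; first exact: nearW.
    have c1 : (fun j => F (s (j + N)%N) x) @ \oo --> f x.
      by rewrite (cvg_shiftn N (fun j => F (s j) x)); exact: cf.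
    have c2 : (fun j => F m x - F (s (j + N)%N) x) @ \oo --> F m x - f x.
      by apply: cvgB => //; exact: cvg_cst.
    exact: (cvgM c2 c2).
  by rewrite (cvg_limn_einf_sup cH).1.
apply: (le_trans (fatou mu measurableT mH H0)).
rewrite limn_einf_lim; apply: lime_le; first exact: is_cvg_einfs.
apply: nearW => n; apply: (@le_trans _ _ (\int[mu]_x H n x)%E).
  by apply: ereal_inf_lbound; exists n => //=.
by apply: hN => //; rewrite (leq_trans _ (sj _)) // leq_addl.
Qed.

Lemma normc2E (z : R[i]) : normc z ^+ 2 = cRe z ^+ 2 + cIm z ^+ 2.
Proof. by case: z => x y /=; rewrite sqr_sqrtr // addr_ge0 ?sqr_ge0. Qed.

Lemma L2_complete (F : nat -> T -> R[i]) :
  (forall n, cmeas (F n)) ->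
  (forall e : R, 0 < e -> exists N, forall m n, (N <= m)%N -> (N <= n)%N ->
     (\int[mu]_x (normc (F m x - F n x) ^+ 2)%:E <= e%:E)%E) ->
  exists2 f : T -> R[i], cmeas f &
    forall e : R, 0 < e -> exists N, forall m, (N <= m)%N ->
     (\int[mu]_x (normc (F m x - f x) ^+ 2)%:E <= e%:E)%E.
Proof.
move=> mF cF.
have m2 (g h : T -> R) : measurable_fun setT g -> measurable_fun setT h ->
    measurable_fun setT (fun x => ((g x - h x) ^+ 2)%:E).
  by move=> mg mh; apply/measurable_EFinP; apply: measurable_funX; exact: measurable_funB.
have cReB (x y : R[i]) : cRe (x - y) = cRe x - cRe y by case: x y => ? ? [].
have cImB (x y : R[i]) : cIm (x - y) = cIm x - cIm y by case: x y => ? ? [].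
have mn (g h : T -> R[i]) : cmeas g -> cmeas h ->
    measurable_fun setT (fun x => (normc (g x - h x) ^+ 2)%:E).
  move=> [g1 g2] [h1 h2]; under eq_fun do rewrite normc2E cReB cImB EFinD.
  by apply: emeasurable_funD; exact: m2.
have [|f1 mf1 hf1] := @L2_complete_real (fun n x => cRe (F n x)) (fun n => (mF n).1).
  move=> e /cF[N hN]; exists N => m n Nm Nn; apply: le_trans (hN m n Nm Nn).
  apply: ge0_le_integral => //.
  - by move=> x _; rewrite lee_fin sqr_ge0.
  - by apply: m2; [exact: (mF m).1|exact: (mF n).1].
  - exact: mn.
  - by move=> x _; rewrite lee_fin normc2E cReB lerDl sqr_ge0.
have [|f2 mf2 hf2] := @L2_complete_real (fun n x => cIm (F n x)) (fun n => (mF n).2).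
  move=> e /cF[N hN]; exists N => m n Nm Nn; apply: le_trans (hN m n Nm Nn).
  apply: ge0_le_integral => //.
  - by move=> x _; rewrite lee_fin sqr_ge0.
  - by apply: m2; [exact: (mF m).2|exact: (mF n).2].
  - exact: mn.
  - by move=> x _; rewrite lee_fin normc2E cImB lerDr sqr_ge0.
exists (fun x => f1 x +i* f2 x) => // e e0.
have [N1 h1] := hf1 (e / 2) (divr_gt0 e0 (ltr0n R 2)).
have [N2 h2] := hf2 (e / 2) (divr_gt0 e0 (ltr0n R 2)).
exists (maxn N1 N2) => m; rewrite geq_max => /andP[m1 m2'].
rewrite [X in (X <= _)%E](_ : _ =
    \int[mu]_x (((cRe (F m x) - f1 x) ^+ 2)%:E + ((cIm (F m x) - f2 x) ^+ 2)%:E))%E; last first.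
  by apply: eq_integral => x _; rewrite normc2E cReB cImB EFinD.
rewrite ge0_integralD //.
- by rewrite (splitr e) EFinD leeD ?h1 ?h2.
- by move=> x _; rewrite lee_fin sqr_ge0.
- by apply: m2; [exact: (mF m).1|].
- by move=> x _; rewrite lee_fin sqr_ge0.
- by apply: m2; [exact: (mF m).2|].
Qed.

End L2Complete.

(** * Polynomial Gaussians are Schwartz functions *)

Section PolynomialGaussians.
Context {R : realType}.
Local Notation C := R[i].
Implicit Types (u v : R * R).

Definition gmono (a b : nat) u : R := u.1 ^+ a * u.2 ^+ b * gauss2 u.

(** The span of monomials times [gauss2]: it contains the twisted Hermite functions, is stable under
    partial derivatives, and its members decay faster than any power, so finite Hermite sums are
    Schwartz functions. *)
Inductive pgauss : (R * R -> C) -> Prop :=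
| pgauss_mono c a b : pgauss (fun u => c * (gmono a b u)%:C)
| pgaussD f g : pgauss f -> pgauss g -> pgauss (fun u => f u + g u).

Lemma differentiable_fst u : differentiable (fst : R * R -> R) u.
Proof. by apply: linear_differentiable => x; exact: cvg_fst. Qed.

Lemma differentiable_snd u : differentiable (snd : R * R -> R) u.
Proof. by apply: linear_differentiable => x; exact: cvg_snd. Qed.

Lemma differentiable_gmono a b u : differentiable (gmono a b) u.
Proof.
have df := differentiable_fst u; have ds := differentiable_snd u.
have dg : differentiable (gauss2 : R * R -> R) u.
  apply: (@differentiable_comp _ _ _ _ (fun u : R * R => - ((u.1 ^+ 2 + u.2 ^+ 2) / 2)) expR).
    apply: differentiableN; apply: differentiableM => //.
    by apply: differentiableD; apply: differentiableM.
  by apply/derivable1_diffP; exact: ex_derive.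
have -> : gmono a b = (fst : R * R -> R) ^+ a * (snd : R * R -> R) ^+ b * (gauss2 : R * R -> R).
  by apply/funext => v; rewrite /gmono !fctE.
have dX (f : R * R -> R) n : differentiable f u -> differentiable (f ^+ n) u.
  case: n => [|n]; last exact: differentiableX.
  by rewrite expr0 => _; exact: differentiable_cst.
apply: differentiableM => //.
by apply: differentiableM; exact: dX.
Qed.

Let derive_gauss1 a (k t : R) : is_derive t 1 (fun t => t ^+ a * k * expR (- ((t ^+ 2) / 2)))
  (a%:R * (t ^+ a.-1 * k * expR (- ((t ^+ 2) / 2))) - t ^+ a.+1 * k * expR (- ((t ^+ 2) / 2))).
Proof.
have dX : is_derive t 1 (fun x : R => x ^+ a * k) (a%:R * t ^+ a.-1 * k).
  rewrite (_ : (fun x : R => x ^+ a * k) = (id : R -> R) ^+ a * cst k); last first.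
    by apply/funext => x; rewrite !fctE.
  apply: is_derive_eq; rewrite /GRing.scale /= !fctE /cst /=; ring.
have dE : is_derive t 1 (fun t => expR (- ((t ^+ 2) / 2))) (- t * expR (- ((t ^+ 2) / 2))).
  by apply: is_derive_eq; rewrite /GRing.scale /=; field.
apply: (is_derive_eq (is_deriveM dX dE)).
rewrite /GRing.scale /= (exprS t a); ring.
Qed.

Lemma derive_gmono_fst a b u :
  'D_(1, 0) (gmono a b) u = a%:R * gmono a.-1 b u - gmono a.+1 b u.
Proof.
pose k := u.2 ^+ b * expR (- (u.2 ^+ 2 / 2)).
have E a' t : gmono a' b (t, u.2) = t ^+ a' * k * expR (- (t ^+ 2 / 2)).
  rewrite /gmono /gauss2 /= mulrDl opprD expRD /k; ring.
pose g t := t ^+ a * k * expR (- (t ^+ 2 / 2)).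
transitivity ('D_1 g u.1); last first.
  by rewrite (@derive_val _ _ _ _ _ _ _ (derive_gauss1 a k u.1)) -!E -surjective_pairing.
(* The difference quotient along [(1, 0)] coincides with that of the one-variable function [g] at
   [u.1]. *)
suff H : (fun h : R => h^-1 *:
      ((gmono a b \o shift u) (h *: ((1, 0) : R * R)) - gmono a b u)) =
    (fun h : R => h^-1 *: ((g \o shift u.1) (h *: (1 : R)) - g u.1)).
  by rewrite /derive H.
apply/funext => h /=; rewrite /g -!E -surjective_pairing.
congr (_ *: (_ - _)); congr gmono.
by case: u {k E g} => x y; congr pair; rewrite /= ?scaler0 ?mulr0 ?add0r.
Qed.

Lemma derive_gmono_snd a b u :
  'D_(0, 1) (gmono a b) u = b%:R * gmono a b.-1 u - gmono a b.+1 u.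
Proof.
pose k := u.1 ^+ a * expR (- (u.1 ^+ 2 / 2)).
have E b' t : gmono a b' (u.1, t) = t ^+ b' * k * expR (- (t ^+ 2 / 2)).
  rewrite /gmono /gauss2 /= mulrDl opprD expRD /k; ring.
pose g t := t ^+ b * k * expR (- (t ^+ 2 / 2)).
transitivity ('D_1 g u.2); last first.
  by rewrite (@derive_val _ _ _ _ _ _ _ (derive_gauss1 b k u.2)) -!E -surjective_pairing.
suff H : (fun h : R => h^-1 *:
      ((gmono a b \o shift u) (h *: ((0, 1) : R * R)) - gmono a b u)) =
    (fun h : R => h^-1 *: ((g \o shift u.2) (h *: (1 : R)) - g u.2)).
  by rewrite /derive H.
apply/funext => h /=; rewrite /g -!E -surjective_pairing.
congr (_ *: (_ - _)); congr gmono.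
by case: u {k E g} => x y; congr pair; rewrite /= ?scaler0 ?mulr0 ?add0r.
Qed.

Lemma pgauss_ext f g : f =1 g -> pgauss f -> pgauss g.
Proof. by move=> /funext ->. Qed.

Lemma pgaussZ c f : pgauss f -> pgauss (fun u => c * f u).
Proof.
elim=> [c' a b|f1 f2 _ h1 _ h2].
  by apply: pgauss_ext (pgauss_mono (c * c') a b) => u; rewrite mulrA.
by apply: pgauss_ext (pgaussD h1 h2) => u; rewrite mulrDr.
Qed.

Lemma pgauss0 : pgauss (fun=> 0).
Proof. by apply: pgauss_ext (pgauss_mono 0 0 0) => u; rewrite mul0r. Qed.

Lemma pgauss_sum I (s : seq I) (F : I -> R * R -> C) :
  (forall i, pgauss (F i)) -> pgauss (fun u => \sum_(i <- s) F i u).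
Proof.
move=> h; elim: s => [|i s IH].
  by apply: pgauss_ext pgauss0 => u; rewrite big_nil.
by apply: pgauss_ext (pgaussD (h i) IH) => u; rewrite big_cons.
Qed.

Lemma cdiff_pgauss f : pgauss f -> cdiff f.
Proof.
elim=> [c a b|f1 f2 _ h1 _ h2]; last first.
  have := cdiffZD 1 h1 h2; congr cdiff.
  by apply/funext => u; rewrite !fctE /= scale1r.
have E1 : (fun u => complex.Re (c * (gmono a b u)%:C)) = complex.Re c *: gmono a b.
  by apply/funext => u; rewrite cReM /= mulr0 subr0.
have E2 : (fun u => complex.Im (c * (gmono a b u)%:C)) = complex.Im c *: gmono a b.
  by apply/funext => u; rewrite cImM /= mulr0 add0r.
by split=> u; rewrite ?E1 ?E2; apply: differentiableZ; exact: differentiable_gmono.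
Qed.

Lemma cderive_gmono v c a b f : (forall u, 'D_v (gmono a b) u = f u) ->
  cderive v (fun u => c * (gmono a b u)%:C) = (fun u => c * (f u)%:C).
Proof.
move=> h; apply/funext => u; rewrite /cderive -h.
have d := @diff_derivable _ _ _ (gmono a b) u v (differentiable_gmono a b u).
have E1 : (fun u => complex.Re (c * (gmono a b u)%:C)) = complex.Re c *: gmono a b.
  by apply/funext => u'; rewrite cReM /= mulr0 subr0.
have E2 : (fun u => complex.Im (c * (gmono a b u)%:C)) = complex.Im c *: gmono a b.
  by apply/funext => u'; rewrite cImM /= mulr0 add0r.
rewrite E1 E2 !deriveZ //; apply/eqP; rewrite eq_complex cReM cImM /= !mulr0 subr0 add0r.
by rewrite !eqxx.
Qed.

Let pgauss_diff c a b a' b' (k : nat) :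
  pgauss (fun u => c * (k%:R * gmono a b u - gmono a' b' u)%:C).
Proof.
apply: pgauss_ext (pgaussD (pgauss_mono (c * (k%:R : R)%:C) a b) (pgauss_mono (- c) a' b')) => u.
by apply/eqP; rewrite eq_complex !(cReD, cImD, cReM, cImM) /=; apply/andP; split; apply/eqP;
  case: c => x y /=; ring.
Qed.

Lemma pgauss_cderive v f : v = (1, 0) \/ v = (0, 1) -> pgauss f -> pgauss (cderive v f).
Proof.
move=> hv; elim=> [c a b|f1 f2 p1 h1 p2 h2]; last first.
  have := cderiveZD v 1 (cdiff_pgauss p1) (cdiff_pgauss p2); rewrite !scale1r => E.
  rewrite (_ : (fun u => _) = f1 + f2) // E; exact: (pgaussD h1 h2).
case: hv => ->.
  by rewrite (cderive_gmono c (derive_gmono_fst a b)).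
by rewrite (cderive_gmono c (derive_gmono_snd a b)).
Qed.

Lemma pgauss_pderiv a b f : pgauss f -> pgauss (pderiv a b f).
Proof.
move=> pf; rewrite /pderiv; elim: a => [|a IH] /=.
  by elim: b => [//|b IH] /=; apply: pgauss_cderive => //; right.
by apply: pgauss_cderive => //; left.
Qed.

(** Weight, monomial and Gaussian all split between the two coordinates, and each coordinate is
    bounded by [pow_gauss_bound] without linear term. *)
Lemma pgauss_bounded j k f : pgauss f ->
  exists M : R, forall u, `|u.1| ^+ j * `|u.2| ^+ k * normc (f u) <= M.
Proof.
elim=> [c a b|f1 f2 _ [M1 h1] _ [M2 h2]]; last first.
  exists (M1 + M2) => u; apply: le_trans (lerD (h1 u) (h2 u)).
  by rewrite -mulrDr ler_wpM2l ?normc_triangle // mulr_ge0 // exprn_ge0.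
have l0 : 0 < 2^-1 :> R by rewrite invr_gt0.
have [K1 K10 hK1] := pow_gauss_bound 0 (j + a) l0.
have [K2 K20 hK2] := pow_gauss_bound 0 (k + b) l0.
exists (normc c * (K1 * K2)) => u.
have B n (K x : R) : 0 < K -> `|x| ^+ n * expR (- 2^-1 * x ^+ 2 + 0 * x)
    <= K * expR (- (2^-1 / 2 * x ^+ 2)) -> `|x| ^+ n * expR (- (x ^+ 2 / 2)) <= K.
  move=> K0; have -> : - 2^-1 * x ^+ 2 + 0 * x = - (x ^+ 2 / 2) by ring.
  move=> /le_trans; apply.
  rewrite ler_piMr ?(ltW K0) // -expR0 ler_expR oppr_le0.
  by rewrite mulr_ge0 ?sqr_ge0 // divr_ge0 // ltW.
have b1 := B _ _ _ K10 (hK1 u.1); have b2 := B _ _ _ K20 (hK2 u.2).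
rewrite normcM normc_real /gmono !normrM !normrX (ger0_norm (expR_ge0 _)).
rewrite /gauss2 mulrDl opprD expRD.
rewrite [leLHS](_ : _ = normc c * ((`|u.1| ^+ (j + a) * expR (- (u.1 ^+ 2 / 2))) *
  (`|u.2| ^+ (k + b) * expR (- (u.2 ^+ 2 / 2))))); last by rewrite !exprD; ring.
rewrite ler_wpM2l //; first by case: (c) => ? ?; exact: sqrtr_ge0.
by rewrite ler_pM // mulr_ge0 ?exprn_ge0 ?expR_ge0.
Qed.

Lemma pgauss_schwartz f : pgauss f -> is_schwartz f.
Proof.
move=> pf; split=> [a b|j k a b]; first exact/cdiff_pgauss/pgauss_pderiv.
have [M hM] := pgauss_bounded j k (pgauss_pderiv a b pf).
by exists M => _ [u _ <-].
Qed.

Let pgaussM_zc (s : C) f : pgauss f -> pgauss (fun u => (u.1%:C + s * u.2%:C) * f u).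
Proof.
elim=> [c a b|f1 f2 _ h1 _ h2]; last first.
  by apply: pgauss_ext (pgaussD h1 h2) => u; rewrite mulrDr.
apply: pgauss_ext (pgaussD (pgauss_mono c a.+1 b) (pgauss_mono (s * c) a b.+1)) => u.
have hM (x y : R) : (x * y)%:C = x%:C * y%:C by rewrite rmorphM.
by rewrite /gmono !exprS !hM; ring.
Qed.

Let zcE u : zc u = u.1%:C + (0 -i* 1) * u.2%:C.
Proof. by apply/eqP; rewrite eq_complex /=; apply/andP; split; apply/eqP; ring. Qed.

Let zcbE u : zcb u = u.1%:C + (0 +i* 1) * u.2%:C.
Proof. by apply/eqP; rewrite eq_complex /=; apply/andP; split; apply/eqP; ring. Qed.

Lemma pgauss_twisted_hermite m n : pgauss (twisted_hermite m n).
Proof.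
suff h : pgauss (fun u => chermite m n (zc u) (zcb u) * (gauss2 u)%:C).
  by apply: pgauss_ext (pgaussZ (hcoef m n)%:C h) => u; rewrite twisted_hermiteE.
elim: m n => [|m IH] n.
  elim: n => [|n IH] /=.
    apply: pgauss_ext (pgauss_mono 1 0 0) => u.
    by rewrite /gmono !expr0 !mul1r.
  apply: pgauss_ext (pgaussM_zc (0 +i* 1) IH) => u.
  by rewrite -zcbE /= exprS mulrA.
apply: pgauss_ext (pgaussD (pgaussM_zc (0 -i* 1) (IH n)) (pgaussZ (- n%:R) (IH n.-1))) => u.
by rewrite -zcE chermiteSl; ring.
Qed.

Lemma pgauss_hsum N a : pgauss (hsum N a).
Proof.
apply: pgauss_sum => m; apply: pgauss_sum => n.
exact/pgaussZ/pgauss_twisted_hermite.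
Qed.

Lemma hsum_is_schwartz N (a : nat -> nat -> C) : hsum N a \in @schwartz_pred R.
Proof. by rewrite inE; exact/pgauss_schwartz/pgauss_hsum. Qed.

Definition hsum_schwartz N a : schwartz R := Schwartz (hsum_is_schwartz N a).

Lemma cmeas_pgauss f : pgauss f -> cmeas (f : plane R -> C).
Proof.
elim=> [c a b|f1 f2 _ h1 _ h2]; last exact: cmeasD.
apply: cmeasM; first exact: cmeas_cst.
apply: cmeasR; apply: measurable_funM.
  by apply: measurable_funM; apply: measurable_funX.
apply: measurableT_comp => //; apply: measurableT_comp => //.
by apply: measurable_funM => //; apply: measurable_funD; apply: measurable_funX.
Qed.

End PolynomialGaussians.

(** * Pairing with Schwartz functions *)

Section PlaneMeasurable.
Context {R : realType}.
Local Notation C := R[i].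
Local Notation leb := (@lebesgue_measure R).

(** [plane] carries the product sigma-algebra, so an open set has to be written as a countable union
    of boxes with rational corners. *)
Lemma open_plane_measurable (U : set (R * R)) : open U -> measurable (U : set (plane R)).
Proof.
move=> oU.
pose box (q : rat * rat * (rat * rat)) : set (R * R) :=
  (`]ratr q.1.1, ratr q.1.2[%classic : set R) `*` (`]ratr q.2.1, ratr q.2.2[%classic : set R).
(* Boxes not contained in [U] are replaced by [set0], which keeps a countable type as the whole
   index set. *)
have -> : U = \bigcup_(q in [set: rat * rat * (rat * rat)])
    (if `[< box q `<=` U >] then box q else set0).
  apply/seteqP; split=> [u Uu|u [q _]]; last by case: asboolP => // h; exact: h.
  have /nbhs_ballP[e /= e0 hU] : nbhs u U by exact: open_nbhs_nbhs.
  have r1 (x : R) : exists2 a : rat, x - e < ratr a & ratr a < x.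
    have /rat_in_itvoo[a] : x - e < x by rewrite ltrBlDr ltrDl.
    by rewrite inE /= => /itvP h; exists a; rewrite h.
  have r2 (x : R) : exists2 a : rat, x < ratr a & ratr a < x + e.
    have /rat_in_itvoo[a] : x < x + e by rewrite ltrDl.
    by rewrite inE /= => /itvP h; exists a; rewrite h.
  have [a ha ha'] := r1 u.1; have [b hb hb'] := r2 u.1.
  have [c hc hc'] := r1 u.2; have [d hd hd'] := r2 u.2.
  exists ((a, b), (c, d)) => //; case: asboolP => [_|]; last first.
    move=> nP; exfalso; apply: nP => -[x y] /= [/=].
    rewrite !in_itv /= => /andP[x1 x2] /andP[y1 y2].
    by apply: hU; split=> /=; rewrite /ball /= ltr_norml; apply/andP; split; lra.
  by split=> /=; rewrite in_itv /=; apply/andP.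
apply: countable_bigcupT_measurable => [|q]; first exact: countableP.
case: asboolP => // _.
by apply: measurableX; exact: measurable_itv.
Qed.

Lemma continuous_plane_measurable (f : R * R -> R) :
  continuous f -> measurable_fun setT (f : plane R -> R).
Proof.
move=> cf; apply: (measurability _ (RGenOInfty.measurableE R)).
move=> /= _ [_ [a ->]] <-; apply: measurableI => //.
by apply: open_plane_measurable; move/continuousP : cf; apply; exact: interval_open.
Qed.

Lemma cmeas_schwartz (phi : schwartz R) : cmeas (phi : plane R -> C).
Proof.
have : is_schwartz phi by have := schwartzP phi; rewrite inE.
move=> [/(_ 0%N 0%N) [d1 d2] _]; split; apply: continuous_plane_measurable => u;
  apply: differentiable_continuous; [exact: d1|exact: d2].
Qed.

Lemma integrable_oneDsqrV : leb.-integrable setT (EFin \o (fun x => (1 + x ^+ 2)^-1)).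
Proof.
have c : continuous (fun x : R => (1 + x ^+ 2)^-1) by exact: continuous_oneDsqrV.
have p (x : R) : 0 <= (1 + x ^+ 2)^-1 by rewrite invr_ge0 addr_ge0 ?sqr_ge0.
apply/integrableP; split; first by apply/measurable_EFinP; exact: continuous_measurable_fun c.
under eq_integral do rewrite gee0_abs ?lee_fin //.
rewrite ge0_symfun_integralT //; last by move=> x /=; rewrite sqrrN.
rewrite (_ : [set x | _] = (`[0, +oo[%classic : set R)); last first.
  by apply/seteqP; split => x /=; rewrite in_itv /= andbT.
by rewrite integral0y_oneDsqr -EFinM ltry.
Qed.

Local Notation leb2 := (leb2 R).

(** The four bounds with weights 1, q^2, p^2, q^2 p^2 add up to one on (1 + q^2)(1 + p^2)|phi|. As
    that factor is at least 1, |phi|^2 is dominated by a multiple of its inverse, a product of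
    integrable functions. *)
Lemma schwartz_square_integrable (phi : schwartz R) :
  leb2.-integrable setT (EFin \o (fun u => normc (phi u) ^+ 2)).
Proof.
have [_ bp] : is_schwartz phi by have := schwartzP phi; rewrite inE.
have bd j k : exists M : R, forall u, `|u.1| ^+ j * `|u.2| ^+ k * normc (phi u) <= M.
  by have [M hM] := bp j k 0%N 0%N; exists M => u; apply: hM; exists u.
have [M0 h0] := bd 0%N 0%N; have [M1 h1] := bd 2%N 0%N.
have [M2 h2] := bd 0%N 2%N; have [M3 h3] := bd 2%N 2%N.
pose M := M0 + M1 + M2 + M3.
have nn (z : C) : 0 <= normc z by case: z => ? ?; exact: sqrtr_ge0.
have key u : (1 + u.1 ^+ 2) * (1 + u.2 ^+ 2) * normc (phi u) <= M.
  have := h0 u; have := h1 u; have := h2 u; have := h3 u.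
  rewrite !expr0 !mul1r !mulr1 !real_normK ?num_real // /M => a b c d.
  apply: le_trans (lerD (lerD (lerD d c) b) a).
  by rewrite le_eqVlt; apply/orP; left; apply/eqP; ring.
have i2 := integrable_prodM integrable_oneDsqrV integrable_oneDsqrV.
have i2' : leb2.-integrable setT (EFin \o (fun u : plane R =>
    M ^+ 2 * ((1 + u.1 ^+ 2)^-1 * (1 + u.2 ^+ 2)^-1))) by exact: integrableRZ.
apply: le_integrable i2' => //.
  apply/measurable_EFinP/measurable_funX/cmeas_normc; exact: cmeas_schwartz.
move=> u _; rewrite lee_fin ger0_norm ?sqr_ge0 //.
set p := (1 + u.1 ^+ 2); set q := 1 + u.2 ^+ 2.
have p1 : 1 <= p by rewrite lerDl sqr_ge0.
have q1 : 1 <= q by rewrite lerDl sqr_ge0.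
have p0 : 0 < p by rewrite (lt_le_trans ltr01).
have q0 : 0 < q by rewrite (lt_le_trans ltr01).
apply: le_trans (ler_norm _).
rewrite -invfM ler_pdivlMr ?mulr_gt0 // mulrC.
have pq1 : 1 <= p * q by rewrite mulr_ege1.
apply: (@le_trans _ _ ((p * q * normc (phi u)) ^+ 2)).
  rewrite exprMn ler_wpM2r ?sqr_ge0 // expr2 ler_peMr //.
  by rewrite ltW // mulr_gt0.
rewrite ler_pXn2r ?nnegrE //; first exact: key.
  by rewrite mulr_ge0 // ltW // mulr_gt0.
by apply: le_trans (key u); rewrite mulr_ge0 // ltW // mulr_gt0.
Qed.

(** The factor 2 comes from estimating real and imaginary part separately; it cancels the halves in
    the bound used for [pairing_bound]. *)
Lemma normc_cintegral_le (f : R * R -> C) (g : R * R -> R) : cmeas (f : plane R -> C) ->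
  leb2.-integrable setT (EFin \o (g : plane R -> R)) -> (forall u, normc (f u) <= g u) ->
  normc (cint f) <= 2 * \int[leb2]_u g u.
Proof.
move=> mf ig fg; have [ir ii] := cmeas_integrable mf ig fg.
have H (h : plane R -> R) : leb2.-integrable setT (EFin \o h) ->
    (forall u, `|h u| <= normc (f u)) -> `|\int[leb2]_u h u| <= \int[leb2]_u g u.
  move=> ih hf; apply: (le_trans (le_normr_Rintegral measurableT ih)).
  apply: le_Rintegral => //; first exact: integrable_norm.
  by move=> u _; apply: le_trans (fg u).
have a := H _ ir (fun u => ler_Re_normc (f u)); have b := H _ ii (fun u => ler_Im_normc (f u)).
have -> : cint f = (\int[leb2]_u complex.Re (f u))%:C + (0 +i* 1) * (\int[leb2]_u complex.Im (f u))%:C.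
  by apply/eqP; rewrite eq_complex /=; apply/andP; split; apply/eqP; ring.
apply: (le_trans (normc_triangle _ _)).
rewrite normcM !normc_real (_ : normc (0 +i* 1) = 1); last by rewrite /= expr0n expr1n add0r sqrtr1.
by rewrite mul1r mulr_natl mulr2n lerD.
Qed.

Lemma pairing_bound (g : R * R -> C) (phi : schwartz R) (t e : R) :
  0 < t -> cmeas (g : plane R -> C) ->
  (\int[leb2]_u (normc (g u) ^+ 2)%:E <= e%:E)%E ->
  cintegrable leb2 (fun u => g u * phi u) /\
  normc (pairing g phi) <= t * e + (\int[leb2]_u (normc (phi u) ^+ 2)) / t.
Proof.
move=> t0 mg ge.
have mphi := cmeas_schwartz phi.
have ip := schwartz_square_integrable phi.
have ig : leb2.-integrable setT (EFin \o (fun u => normc (g u) ^+ 2)).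
  apply/integrableP; split.
    by apply/measurable_EFinP/measurable_funX/cmeas_normc.
  under eq_integral do rewrite gee0_abs ?lee_fin ?sqr_ge0 //.
  exact: le_lt_trans ge (ltry _).
have t0' : t != 0 by rewrite gt_eqF.
(* AM-GM: |g phi| <= (t |g|^2 + |phi|^2 / t) / 2 *)
have ib : leb2.-integrable setT (EFin \o (fun u => t / 2 * normc (g u) ^+ 2
    + (2 * t)^-1 * normc (phi u) ^+ 2)).
  by apply: integrableRD; exact: integrableRZ.
have bd u : normc (g u * phi u) <= t / 2 * normc (g u) ^+ 2 + (2 * t)^-1 * normc (phi u) ^+ 2.
  rewrite normcM -subr_ge0; set x := normc (g u); set y := normc (phi u).
  have -> : t / 2 * x ^+ 2 + (2 * t)^-1 * y ^+ 2 - x * y = (t * x - y) ^+ 2 / (2 * t) by field.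
  by rewrite divr_ge0 ?sqr_ge0 // mulr_ge0 // ltW.
split; first exact: cmeas_integrable (cmeasM mg mphi) ib bd.
apply: (le_trans (normc_cintegral_le (cmeasM mg mphi) ib bd)).
rewrite RintegralD //; [|exact: integrableRZ|exact: integrableRZ].
rewrite !RintegralZl // mulrDr; apply: lerD; last first.
  by rewrite le_eqVlt; apply/orP; left; apply/eqP; field.
rewrite mulrA (_ : 2 * (t / 2) = t); last by field.
by rewrite ler_pM2l // -lee_fin fineK // integrable_fin_num.
Qed.

End PlaneMeasurable.

(** * Factorization of Hermite series *)

Section L2Norm.
Context {R : realType}.
Local Notation C := R[i].
Local Notation leb2 := (leb2 R).

Lemma L2norm_le (g : R * R -> C) (e : R) : 0 <= e -> cmeas (g : plane R -> C) ->
  (\int[leb2]_u (normc (g u) ^+ 2)%:E <= (4 * pi * e ^+ 2)%:E)%E -> (L2norm g <= e%:E)%E.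
Proof.
move=> e0 mg ge.
have p4 : 0 < 4 * pi :> R by rewrite mulr_gt0 // pi_gt0.
have m2 : measurable_fun setT (fun u : plane R => (normc (g u) ^+ 2)%:E).
  by apply/measurable_EFinP/measurable_funX/cmeas_normc.
have nn (z : C) : 0 <= normc z by case: z => ? ?; exact: sqrtr_ge0.
have E : (\int[@phase_measure R]_u (`|(normc (g u))%:E| `^ 2)%E =
    ((4 * pi)^-1)%:E * \int[leb2]_u (normc (g u) ^+ 2)%:E)%E.
  under eq_integral do rewrite gee0_abs ?lee_fin // poweR_EFin powR_mulrn //.
  rewrite /phase_measure ge0_integral_mscale //.
  by move=> u _; rewrite lee_fin sqr_ge0.
rewrite /L2norm unlock /= E.
have fin : (\int[leb2]_u (normc (g u) ^+ 2)%:E \is a fin_num)%E.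
  rewrite ge0_fin_numE; first exact: le_lt_trans ge (ltry _).
  by apply: integral_ge0 => u _; rewrite lee_fin sqr_ge0.
rewrite -(fineK fin) -EFinM poweR_EFin lee_fin powR12_sqrt.
  rewrite -[leRHS]ger0_norm // -sqrtr_sqr ler_wsqrtr //.
  by rewrite ler_pdivrMl // -lee_fin fineK.
rewrite mulr_ge0 ?invr_ge0 ?(ltW p4) // fine_ge0 //.
by apply: integral_ge0 => u _; rewrite lee_fin sqr_ge0.
Qed.

Lemma L2_intro (g : R * R -> C) (e : R) : cmeas (g : plane R -> C) ->
  (\int[leb2]_u (normc (g u) ^+ 2)%:E <= e%:E)%E -> L2 g.
Proof.
move=> mg ge.
have p4 : 0 < 4 * pi :> R by rewrite mulr_gt0 // pi_gt0.
have e0 : 0 <= e.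
  rewrite -lee_fin; apply: le_trans ge.
  by apply: integral_ge0 => u _; rewrite lee_fin sqr_ge0.
split; [exact: mg.1|exact: mg.2|].
apply: (@le_lt_trans _ _ (Num.sqrt (e / (4 * pi)))%:E); last exact: ltry.
apply: L2norm_le => //; rewrite sqr_sqrtr; last by rewrite divr_ge0 // ltW.
by rewrite mulrC divfK // gt_eqF.
Qed.

Lemma L2cvg_intro (F : nat -> R * R -> C) (f : R * R -> C) :
  (forall n, cmeas (F n : plane R -> C)) -> cmeas (f : plane R -> C) ->
  (forall e : R, 0 < e -> exists N, forall m, (N <= m)%N ->
     (\int[leb2]_x (normc (F m x - f x) ^+ 2)%:E <= e%:E)%E) ->
  L2cvg F f.
Proof.
move=> mF mf h.
have p4 : 0 < 4 * pi :> R by rewrite mulr_gt0 // pi_gt0.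
have n0 k : (0 <= L2norm (fun u => (F k u - f u)%R))%E by exact: Lnorm_ge0.
have key (e : R) : 0 < e -> \forall k \near \oo, (L2norm (fun u => (F k u - f u)%R) <= e%:E)%E.
  (* The tolerance on the squared integral over [leb2] that corresponds to norm [e] for
     [phase_measure]. *)
  move=> e0; have [N hN] := h (4 * pi * e ^+ 2) (mulr_gt0 p4 (exprn_gt0 2 e0)).
  exists N => // m /= Nm; apply: L2norm_le; [exact: ltW| |exact: hN].
  have mN : cmeas ((fun u => (-1) * f u) : plane R -> C).
    by apply: cmeasM => //; exact: cmeas_cst.
  have := cmeasD (mF m) mN; congr cmeas.
  by apply/funext => u; rewrite mulN1r.
apply/fine_cvgP; split.
  have [N _ hN] := key 1 ltr01; exists N => // k Nk.
  by rewrite ge0_fin_numE // (le_lt_trans (hN k Nk)) // ltry.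
apply/cvgrPdist_le => e e0; have [N _ hN] := key e e0.
exists N => // k Nk; have hk := hN k Nk.
rewrite /= sub0r normrN ger0_norm ?fine_ge0 // -lee_fin fineK //.
by rewrite ge0_fin_numE // (le_lt_trans hk) // ltry.
Qed.

End L2Norm.

(** * Convergence of square partial sums *)

Section HermiteSeries.
Context {R : realType}.
Local Notation C := R[i].
Local Notation leb2 := (leb2 R).
Implicit Types a b c : nat -> nat -> C.

Definition sqsum (N : nat) a : R := \sum_(m < N) \sum_(n < N) normc (a m n) ^+ 2.

Let widen2 (V : nmodType) (F : nat -> nat -> V) M N : (M <= N)%N ->
  \sum_(m < M) \sum_(n < M) F m n =
  \sum_(m < N) \sum_(n < N) (if (m < M)%N && (n < M)%N then F m n else 0).
Proof.
move=> MN; rewrite (big_ord_widen N (fun m => \sum_(n < M) F m n)) // big_mkcond.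
apply: eq_bigr => m _; case: ifP => _ /=; last by rewrite big1.
by rewrite (big_ord_widen N (fun n => F m n)) // big_mkcond.
Qed.

(** The difference is again a finite Hermite sum, with the coefficients of the smaller square set to
    0, so Parseval applies to it. *)
Lemma hsum_diff_norm M N a : (M <= N)%N ->
  (\int[leb2]_u (normc (hsum N a u - hsum M a u) ^+ 2)%:E =
   (4 * pi * (sqsum N a - sqsum M a))%:E)%E.
Proof.
move=> MN; pose b m n := if (m < M)%N && (n < M)%N then 0 else a m n.
have E u : hsum N a u - hsum M a u = hsum N b u.
  rewrite /hsum (widen2 (fun m n => a m n * twisted_hermite m n u) MN) -sumrB.
  apply: eq_bigr => m _; rewrite -sumrB; apply: eq_bigr => n _.
  by rewrite /b; case: ifP => _; rewrite ?subrr ?mul0r ?subr0.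
under eq_integral do rewrite E.
rewrite hsum_norm -(pair_bigA _ (fun m n : 'I_N => normc (b m n) ^+ 2)) /=.
congr (_ * _)%:E; rewrite /sqsum (widen2 (fun m n => normc (a m n) ^+ 2) MN) -sumrB.
apply: eq_bigr => m _; rewrite -sumrB; apply: eq_bigr => n _.
by rewrite /b; case: ifP => _; rewrite ?subrr ?subr0 // /normc /= expr0n addr0 sqrtr0 expr0n.
Qed.

Lemma sqsum_homo a : {homo (fun N => sqsum N a) : M N / (M <= N)%N >-> M <= N}.
Proof.
move=> M N MN; rewrite /sqsum (widen2 (fun m n => normc (a m n) ^+ 2) MN).
apply: ler_sum => m _; apply: ler_sum => n _.
by case: ifP => // _; exact: sqr_ge0.
Qed.

(** The nondecreasing bounded sequence [sqsum] converges, and Parseval turns its increments into L2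
    distances. *)
Lemma hsum_cauchy a (K : R) : (forall N, sqsum N a <= K) ->
  forall e : R, 0 < e -> exists N, forall m n, (N <= m)%N -> (N <= n)%N ->
   (\int[leb2]_u (normc (hsum m a u - hsum n a u) ^+ 2)%:E <= e%:E)%E.
Proof.
move=> hK e e0.
have p4 : 0 < 4 * pi :> R by rewrite mulr_gt0 // pi_gt0.
have cs : cvgn (fun N => sqsum N a).
  apply: nondecreasing_is_cvgn; first exact: sqsum_homo.
  by exists K => _ [N _ <-].
pose l := limn (fun N => sqsum N a).
have le_l N : sqsum N a <= l by apply: nondecreasing_cvgn_le => //; exact: sqsum_homo.
have [N _ hN] : \forall N \near \oo, `|l - sqsum N a| <= e / (4 * pi).
  by move/cvgrPdist_le : cs; apply; rewrite divr_gt0.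
have wlog_le m n : (N <= m)%N -> (m <= n)%N ->
    (\int[leb2]_u (normc (hsum n a u - hsum m a u) ^+ 2)%:E <= e%:E)%E.
  move=> Nm mn; rewrite hsum_diff_norm // lee_fin mulrC -ler_pdivlMr //.
  have := hN m Nm; rewrite ger0_norm ?subr_ge0 // => h.
  by apply: le_trans h; rewrite lerD2r.
exists N => m n Nm Nn; have [mn|/ltnW nm] := leqP m n; last exact: wlog_le.
have := wlog_le m n Nm mn; congr (_ <= _)%E; apply: eq_integral => u _.
by rewrite -opprB -mulN1r normcM (_ : normc (-1) = 1) ?mul1r //
  /normc /= oppr0 expr0n addr0 sqrrN expr1n sqrtr1.
Qed.

Lemma cmeas_hsum N a : cmeas (hsum N a : plane R -> C).
Proof. exact/cmeas_pgauss/pgauss_hsum. Qed.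

Lemma hsum_cvg a (K : R) : (forall N, sqsum N a <= K) ->
  exists f : R * R -> C, [/\ cmeas (f : plane R -> C), L2 f &
    forall e : R, 0 < e -> exists N, forall m, (N <= m)%N ->
     (\int[leb2]_u (normc (hsum m a u - f u) ^+ 2)%:E <= e%:E)%E].
Proof.
move=> hK.
have [f mf hf] := L2_complete (fun n => cmeas_hsum n a) (hsum_cauchy hK).
exists f; split => //.
(* A single partial sum S within distance 1 suffices, by |f|^2 <= 2 |S|^2 + 2 |S - f|^2 and Parseval
   for S. *)
have [N hN] := hf 1 ltr01.
have h0 : (\int[leb2]_u (normc (hsum N a u) ^+ 2)%:E <= (4 * pi * K)%:E)%E.
  rewrite hsum_norm lee_fin ler_wpM2l ?mulr_ge0 ?pi_ge0 //.
  by have := hK N; rewrite /sqsum pair_bigA.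
have mD : cmeas ((fun u => hsum N a u - f u) : plane R -> C).
  have := cmeasD (cmeas_hsum N a) (cmeasM (cmeas_cst (-1)) mf); congr cmeas.
  by apply/funext => u; rewrite mulN1r.
have msq (g : plane R -> C) : cmeas g -> measurable_fun setT (fun u => (normc (g u) ^+ 2)%:E).
  by move=> mg; apply/measurable_EFinP/measurable_funX/cmeas_normc.
have nn (z : C) : 0 <= normc z by case: z => ? ?; exact: sqrtr_ge0.
apply: (@L2_intro _ _ (2 * (4 * pi * K) + 2 * 1)) => //.
apply: (@le_trans _ _ (\int[leb2]_u (2%:E * (normc (hsum N a u) ^+ 2)%:E +
    2%:E * (normc (hsum N a u - f u) ^+ 2)%:E))%E).
  apply: ge0_le_integral => //.
  - by move=> u _; rewrite lee_fin sqr_ge0.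
  - exact: msq.
  - by apply: emeasurable_funD; apply: measurable_funeM; apply: msq => //; exact: cmeas_hsum.
  move=> u _; rewrite -!EFinM -EFinD lee_fin.
  have : normc (f u) <= normc (hsum N a u) + normc (hsum N a u - f u).
    have {1}-> : f u = hsum N a u + (-1) * (hsum N a u - f u) by ring.
    apply: (le_trans (normc_triangle _ _)); rewrite lerD2l normcM.
    by rewrite (_ : normc (-1) = 1) ?mul1r // /normc /= oppr0 expr0n addr0 sqrrN expr1n sqrtr1.
  move: (nn (f u)) (nn (hsum N a u)) (nn (hsum N a u - f u)).
  move: (normc (f u)) (normc (hsum N a u)) (normc (hsum N a u - f u)) => x y z x0 y0 z0 xyz.
  apply: (@le_trans _ _ ((y + z) ^+ 2)).
    by rewrite ler_pXn2r ?nnegrE ?addr_ge0.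
  by rewrite -subr_ge0 (_ : _ - _ = (y - z) ^+ 2) ?sqr_ge0 //; ring.
rewrite ge0_integralD //; last 4 first.
- by move=> u _; rewrite mule_ge0 // lee_fin sqr_ge0.
- by apply: measurable_funeM; apply: msq; exact: cmeas_hsum.
- by move=> u _; rewrite mule_ge0 // lee_fin sqr_ge0.
- by apply: measurable_funeM; exact: msq.
rewrite !ge0_integralZl_EFin //; last 4 first.
- by move=> u _; rewrite lee_fin sqr_ge0.
- exact: msq.
- by move=> u _; rewrite lee_fin sqr_ge0.
- by apply: msq; exact: cmeas_hsum.
rewrite [leRHS](_ : _ = 2%:E * (4 * pi * K)%:E + 2%:E * 1%:E)%E //; apply: leeD.
  by rewrite lee_pmul2l.
by rewrite lee_pmul2l //; exact: hN.
Qed.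

End HermiteSeries.

Section Factorization.
Context {R : realType}.
Local Notation C := R[i].
Local Notation leb2 := (leb2 R).
Implicit Types a b c : nat -> nat -> C.

Lemma twisted_hermite_pairing_integrable m n (phi : schwartz R) :
  cintegrable leb2 (fun u => twisted_hermite m n u * phi u).
Proof.
have [[I _] _] := @twisted_hermite_ortho R m n m n.
pose e := \int[leb2]_u complex.Re (twisted_hermite m n u * conjc (twisted_hermite m n u)).
have mt : cmeas (twisted_hermite m n : plane R -> C).
  exact/cmeas_pgauss/pgauss_twisted_hermite.
have ge : (\int[leb2]_u (normc (twisted_hermite m n u) ^+ 2)%:E <= e%:E)%E.
  rewrite /e /Rintegral fineK; last exact: integrable_fin_num.
  by rewrite le_eqVlt; apply/orP; left; apply/eqP; apply: eq_integral => u _;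
    rewrite -normc_sqr.
by have [] := pairing_bound phi ltr01 mt ge.
Qed.

Lemma pairing_hsum N c (phi : schwartz R) : pairing (hsum N c) phi =
  \sum_(m < N) \sum_(n < N) c m n * pairing (twisted_hermite m n) phi.
Proof.
have I := twisted_hermite_pairing_integrable.
rewrite /pairing pair_bigA /= cintE.
transitivity (cintegral leb2 (fun u => \sum_(p : 'I_N * 'I_N)
    c p.1 p.2 * (twisted_hermite p.1 p.2 u * phi u))).
  apply: eq_cintegral => u; rewrite hsum_pair mulr_suml; apply: eq_bigr => p _.
  by rewrite mulrA.
rewrite cintegral_sum => [|p]; last exact/cintegrableZ/I.
by apply: eq_bigr => p _; rewrite cintegralZ //; exact: I.
Qed.

Lemma normc_eq0_le (z : C) : (forall e : R, 0 < e -> normc z <= e) -> z = 0.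
Proof.
move=> h; apply: eq0_normc; apply/eqP; rewrite eq_le; apply/andP; split; last first.
  by case: (z) => ? ?; exact: sqrtr_ge0.
by apply/ler_addgt0Pl => e e0; rewrite addr0; exact: h.
Qed.

(** The pairings of the partial sums with [phi] tend to [T phi] by hypothesis and to [pairing h phi]
    by L2 convergence. *)
Lemma hermite_series_pairing c (K : R) (T : tempered R) h : (forall N, sqsum N c <= K) ->
  hermite_series c T -> cmeas (h : plane R -> C) -> L2 h ->
  (forall e : R, 0 < e -> exists N, forall m, (N <= m)%N ->
     (\int[leb2]_u (normc (hsum m c u - h u) ^+ 2)%:E <= e%:E)%E) ->
  forall phi, T phi = pairing h phi.
Proof.
move=> hK hT mh Lh hh phi.
pose B := \int[leb2]_u (normc (phi u) ^+ 2).
have B0 : 0 <= B by apply: Rintegral_ge0 => u _; exact: sqr_ge0.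
apply/eqP; rewrite -subr_eq0; apply/eqP/normc_eq0_le => e e0.
have e3 : 0 < e / 3 by rewrite divr_gt0.
have nB (z : C) : normc (- z) = normc z by exact: normcN.
have mD m : cmeas ((fun u => hsum m c u - h u) : plane R -> C).
  have := cmeasD (cmeas_hsum m c) (cmeasM (cmeas_cst (-1)) mh); congr cmeas.
  by apply/funext => u; rewrite mulN1r.
have iS m : cintegrable leb2 (fun u => hsum m c u * phi u).
  have ge : (\int[leb2]_u (normc (hsum m c u) ^+ 2)%:E <= (4 * pi * K)%:E)%E.
    rewrite hsum_norm lee_fin ler_wpM2l ?mulr_ge0 ?pi_ge0 //.
    by have := hK m; rewrite /sqsum pair_bigA.
  by have [] := pairing_bound phi ltr01 (cmeas_hsum m c) ge.
(* Chosen so that [B / t <= e / 3], with [+ 1] keeping it positive when [B = 0]; the tolerance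
   [e / 3 / t] then makes the other term of [pairing_bound] equal to [e / 3]. *)
pose t := (B + 1) / (e / 3).
have t0 : 0 < t by rewrite divr_gt0 // ltr_wpDl.
have [N1 h1] := hh (e / 3 / t) (divr_gt0 e3 t0).
have /cvgrPdist_le/(_ _ e3)[N2 _ h2] := hT phi.
pose m := maxn N1 N2.
have b1 : normc (pairing (fun u => hsum m c u - h u) phi) <= e / 3 + e / 3.
  have [_ b] := pairing_bound phi t0 (mD m) (h1 m (leq_maxl _ _)).
  apply: le_trans b _; apply: lerD; first by rewrite mulrC divfK // gt_eqF.
  rewrite ler_pdivrMr // /t mulrC divfK ?gt_eqF //.
  by rewrite lerDl ler01.
have b2 : normc (pairing (hsum m c) phi - T phi) <= e / 3.
  have := h2 m (leq_maxr _ _); rewrite /= sub0r normrN pairing_hsum ger0_norm //.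
  by case: (_ - _) => ? ?; exact: sqrtr_ge0.
have E : pairing (fun u => hsum m c u - h u) phi = pairing (hsum m c) phi - pairing h phi.
  have [id_ _] := pairing_bound phi t0 (mD m) (h1 m (leq_maxl _ _)).
  have ih : cintegrable leb2 (fun u => h u * phi u).
    have := cintegrableD (iS m) (cintegrableZ (-1) id_); apply: eq_cintegrable => u; ring.
  rewrite /pairing !cintE -[- _]mulN1r -cintegralZ // -cintegralD //; last exact: cintegrableZ.
  by apply: eq_cintegral => u; ring.
rewrite (_ : T phi - pairing h phi = (pairing (fun u => hsum m c u - h u) phi) +
   - (pairing (hsum m c) phi - T phi)); last by rewrite E; ring.
apply: le_trans (normc_triangle _ _) _; rewrite nB.
by apply: le_trans (lerD b1 b2) _; lra.
Qed.

(** The truncated matrix product is required to give [c] at every size [N]; the product of the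
    approximating Schwartz functions is then itself a partial sum of [c], whose L2 limit is [h]. *)
Lemma I00_of_coefficients a b c (Ka Kb Kc : R) (T : tempered R) :
  (forall N, sqsum N a <= Ka) -> (forall N, sqsum N b <= Kb) -> (forall N, sqsum N c <= Kc) ->
  (forall N m l, (m < N)%N -> (l < N)%N -> \sum_(n < N) a m n * b n l = c m l) ->
  hermite_series c T -> I00 R T.
Proof.
move=> ha hb hc abc hT.
have [f [mf Lf cf]] := hsum_cvg ha; have [g [mg Lg cg]] := hsum_cvg hb.
have [h [mh Lh ch]] := hsum_cvg hc.
exists f, g, h; split => //; last exact: hermite_series_pairing ch.
exists (fun N => hsum_schwartz N a), (fun N => hsum_schwartz N b); split.
- exact: (L2cvg_intro (fun n => cmeas_hsum n a) mf cf).
- exact: (L2cvg_intro (fun n => cmeas_hsum n b) mg cg).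
rewrite (_ : (fun k => _) = (fun k => hsum k c)).
  exact: (L2cvg_intro (fun n => cmeas_hsum n c) mh ch).
apply/funext => N; rewrite twisted_hsum; apply/funext => u.
by apply: eq_bigr => m _; apply: eq_bigr => l _; rewrite abc.
Qed.

(** A discrete integral test: the odd numbers have spacing 2, so each term is at most [(2 * d)^-1]
    times a difference of powers with exponent [- d], and these telescope. The leading 1 is the term
    [m = 0]. *)
Lemma sum_odd_powR_le (r : R) N : 1 < r ->
  \sum_(m < N) (2 * m + 1)%:R `^ (- r) <= 1 + (2 * (r - 1))^-1.
Proof.
move=> r1; pose d := r - 1; have d0 : 0 < d by rewrite subr_gt0.
pose x (m : nat) : R := (2 * m + 1)%:R.
have x0 m : 0 < x m by rewrite /x addn1 ltr0n.
have step m : x m.+1 `^ (- r) <= (2 * d)^-1 * (x m `^ (- d) - x m.+1 `^ (- d)).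
  have xS : x m = x m.+1 - 2.
    have -> : x m.+1 = x m + 2 by rewrite /x -natrD; congr (_%:R); lia.
    by rewrite addrK.
  have y0 := x0 m.+1; have y0' : x m.+1 != 0 by rewrite gt_eqF.
  (* With [y = x m.+1] this is ln(1 - 2/y) <= -2/y. Multiplying by [- d] and exponentiating gives (y
     - 2)^(-d) >= y^(-d) exp(2d/y), and the last factor is at least 1 + 2d/y. *)
  have lnx : ln (x m) <= ln (x m.+1) - 2 / x m.+1.
    rewrite -lerBlDl -ln_div ?posrE //.
    have -> : x m / x m.+1 = 1 + - (2 / x m.+1) by rewrite xS; field.
    apply: le_ln1Dx; rewrite ltrN2 ltr_pdivrMr // mul1r -subr_gt0 -xS; exact: x0.
  have B : x m.+1 `^ (- d) * (1 + 2 * d / x m.+1) <= x m `^ (- d).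
    rewrite /powR !gt_eqF //.
    apply: (@le_trans _ _ (expR (- d * ln (x m.+1)) * expR (2 * d / x m.+1))).
      by rewrite ler_wpM2l ?expR_ge0 // expR_ge1Dx.
    rewrite -expRD ler_expR !mulNr -subr_ge0.
    have -> : - (d * ln (x m)) - (- (d * ln (x m.+1)) + 2 * d / x m.+1) =
      d * (ln (x m.+1) - 2 / x m.+1 - ln (x m)) by ring.
    by rewrite mulr_ge0 ?(ltW d0) // subr_ge0.
  have -> : x m.+1 `^ (- r) = x m.+1 `^ (- d) / x m.+1.
    have -> : - r = - d + - 1 by rewrite /d; ring.
    by rewrite powRD ?y0' ?implybT // powR_inv1 // ltW.
  rewrite ler_pdivlMl ?mulr_gt0 // lerBrDl; apply: le_trans B.
  by rewrite le_eqVlt; apply/orP; left; apply/eqP; field.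
have main n : \sum_(m < n.+1) x m `^ (- r) <= 1 + (2 * d)^-1 * (1 - x n `^ (- d)).
  elim: n => [|n IH].
    by rewrite big_ord_recl big_ord0 addr0 /x muln0 add0n !powR1 subrr mulr0 addr0.
  rewrite big_ord_recr /=; apply: le_trans (lerD IH (step n)) _.
  by rewrite le_eqVlt; apply/orP; left; apply/eqP; ring.
case: N => [|N]; first by rewrite big_ord0 addr_ge0 // invr_ge0 mulr_ge0 // ltW.
apply: le_trans (main N) _; rewrite lerD2l ler_piMr ?invr_ge0 ?mulr_ge0 ?(ltW d0) //.
by rewrite gerBl powR_ge0.
Qed.

Lemma weighted_sum_le (s t : R) c N : (weighted_norm2 s t c < +oo)%E ->
  \sum_(m < N) \sum_(n < N) ((2 * m + 1)%:R `^ s * (2 * n + 1)%:R `^ t * normc (c m n) ^+ 2)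
    <= fine (weighted_norm2 s t c).
Proof.
move=> fin.
set w := fun m n => (2 * m + 1)%:R `^ s * (2 * n + 1)%:R `^ t * normc (c m n) ^+ 2.
have w0 m n : (0 <= (w m n)%:E)%E.
  by rewrite lee_fin; apply: mulr_ge0; [apply: mulr_ge0; exact: powR_ge0|exact: sqr_ge0].
have s0 m : (0 <= \sum_(n <oo) (w m n)%:E)%E by apply: nneseries_ge0 => n _ _.
rewrite -lee_fin fineK; last first.
  by rewrite ge0_fin_numE //; apply: nneseries_ge0 => m _ _; exact: s0.
apply: (@le_trans _ _ (\sum_(0 <= m < N) \sum_(n <oo) (w m n)%:E)%E); last first.
  exact: nneseries_lim_ge.
rewrite big_mkord -sumEFin; apply: lee_sum => m _; rewrite -sumEFin.
apply: (@le_trans _ _ (\sum_(0 <= n < N) (w m n)%:E)%E); last exact: nneseries_lim_ge.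
by rewrite big_mkord.
Qed.

Lemma odd_powR_ge1 (r : R) (m : nat) : 0 <= r -> 1 <= (2 * m + 1)%:R `^ r :> R.
Proof.
move=> r0; apply: (@le_trans _ _ ((2 * m + 1)%:R `^ 0)); first by rewrite powRr0.
by rewrite ler_powR // addn1 ler1n.
Qed.

Lemma normc_powR_sqr (r : R) (m : nat) (z : C) :
  normc (((2 * m + 1)%:R `^ (r / 2))%:C * z) ^+ 2 = (2 * m + 1)%:R `^ r * normc z ^+ 2.
Proof.
rewrite normcM normc_real ger0_norm ?powR_ge0 // exprMn; congr (_ * _).
rewrite expr2 -powRD; last by apply/implyP => _; rewrite pnatr_eq0 addn1.
by congr (_ `^ _); rewrite -splitr.
Qed.

(** The exponent is halved because the squares of the entries are summed, and because its inverse is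
    then the square root of the weight in the norm. *)
Definition diag_powR (r : R) m n : C := if m == n then ((2 * m + 1)%:R `^ (- r / 2))%:C else 0.

Lemma sqsum_diag_powR_le r N : 1 < r -> sqsum N (diag_powR r) <= 1 + (2 * (r - 1))^-1.
Proof.
move=> r1; apply: le_trans (sum_odd_powR_le N r1); apply: ler_sum => m _.
rewrite (bigD1 m) //= big1 ?addr0 => [|n nm].
  by rewrite /diag_powR eqxx -[X in normc X]mulr1 normc_powR_sqr /=
    expr1n expr0n addr0 sqrtr1 expr1n mulr1.
by rewrite /diag_powR (negbTE (_ : m != n :> nat)) 1?eq_sym // /normc /= expr0n addr0 sqrtr0 expr0n.
Qed.

Lemma diag_powRK (r : R) m : diag_powR r m m * ((2 * m + 1)%:R `^ (r / 2))%:C = 1 :> C.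
Proof.
by rewrite /diag_powR eqxx -rmorphM /= mulNr powRN mulVf // gt_eqF // powR_gt0 // addn1 ltr0n.
Qed.

Lemma diag_powR_mull (r : R) b N m l : (m < N)%N ->
  \sum_(n < N) diag_powR r m n * b n l = diag_powR r m m * b m l.
Proof.
move=> mN; rewrite (bigD1 (Ordinal mN)) //= big1 ?addr0 // => n nm.
by rewrite /diag_powR (negbTE (_ : m != n :> nat)) ?mul0r // eq_sym.
Qed.

Lemma diag_powR_mulr (r : R) a N m l : (l < N)%N ->
  \sum_(n < N) a m n * diag_powR r n l = a m l * diag_powR r l l.
Proof.
move=> lN; rewrite (bigD1 (Ordinal lN)) //= big1 ?addr0 // => n nl.
by rewrite /diag_powR (negbTE (_ : (n : nat) != l)) ?mulr0.
Qed.

Lemma le_sqsum a b N : (forall m n, normc (a m n) ^+ 2 <= normc (b m n) ^+ 2) ->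
  sqsum N a <= sqsum N b.
Proof. by move=> h; apply: ler_sum => m _; apply: ler_sum => n _. Qed.

Lemma le_normc_powR_sqr (r : R) m (z : C) : 0 <= r ->
  normc z ^+ 2 <= normc (((2 * m + 1)%:R `^ (r / 2))%:C * z) ^+ 2.
Proof. by move=> r0; rewrite normc_powR_sqr ler_peMl ?sqr_ge0 // odd_powR_ge1. Qed.

End Factorization.

Theorem theorem6 (R : realType) (r : R) (hr : 1 < r) :
  Gspace r 0 `|` Gspace 0 r `<=` I00 R.
Proof.
have r0 : 0 <= r by rewrite (le_trans ler01) // ltW.
have hd N : sqsum N (diag_powR r) <= 1 + (2 * (r - 1))^-1 by exact: sqsum_diag_powR_le.
move=> T [|] [c [fin hT]].
  pose b m n := ((2 * m + 1)%:R `^ (r / 2))%:C * c m n.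
  have hb N : sqsum N b <= fine (weighted_norm2 r 0 c).
    apply: le_trans (weighted_sum_le N fin); apply: ler_sum => m _; apply: ler_sum => n _.
    by rewrite normc_powR_sqr powRr0 mulr1.
  (* The weights are at least 1, so [c] is square summable as well; this makes the product itself an
     L2 function. *)
  have hc N : sqsum N c <= fine (weighted_norm2 r 0 c).
    by apply: le_trans (hb N); apply: le_sqsum => m n; exact: le_normc_powR_sqr.
  apply: (I00_of_coefficients hd hb hc _ hT) => N m l mN _.
  by rewrite diag_powR_mull // mulrA diag_powRK mul1r.
pose a m n := ((2 * n + 1)%:R `^ (r / 2))%:C * c m n.
have ha N : sqsum N a <= fine (weighted_norm2 0 r c).
  apply: le_trans (weighted_sum_le N fin); apply: ler_sum => m _; apply: ler_sum => n _.
  by rewrite normc_powR_sqr powRr0 mul1r.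
have hc N : sqsum N c <= fine (weighted_norm2 0 r c).
  by apply: le_trans (ha N); apply: le_sqsum => m n; exact: le_normc_powR_sqr.
apply: (I00_of_coefficients ha hd hc _ hT) => N m l _ lN.
by rewrite diag_powR_mulr // mulrC mulrA diag_powRK mul1r.
Qed.
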